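(* For any irreducible $\mathcal{H}$-submodule $W$ of $V$ there exist a unique $\mu\in\{0,1\}^N$ and a unique $\lambda\subseteq\{1,\ldots,N\}$ such that $(\mu,\lambda)$ is admissible, $\lambda$ is column-full with respect to $\mu$, and $W$ is generated (as an $\mathcal{H}$-module) by a nonzero vector in $E^*_\mu E_\lambda V$. Moreover, $W$ is determined up to isomorphism of $\mathcal{H}$-modules by $\mu$ and $\lambda$.
   Context: $q$ a prime power, $N\ge1$, $H$ an $N$-dimensional $\mathbb{F}_q$-space, $P$ its set of subspaces, fixed full flag $0=x_0\subsetneq\cdots\subsetneq x_N=H$ ($\dim x_i=i$). Location of $y\in P$: the $\mu\in\{0,1\}^N$ with $\dim(y\cap x_m)=\mu_1+\cdots+\mu_m$ for all $m$; $P_\mu$ the subspaces with location $\mu$; $\widehat m$ the $m$-th unit vector. $y$ $m$-covers $z$ if $z\subseteq y$, $\dim z=\dim y-1$ and location$(y)$=location$(z)+\widehat m$. $V=\mathbb{C}^P$. $E^*_\mu$ is the diagonal matrix with $(y,y)$-entry $1$ iff $y\in P_\mu$; $(L_m)_{y,z}=1$ iff $z$ $m$-covers $y$, else $0$; $R_m=L_m^T$. $\mathcal{H}$ is the subalgebra of $\mathrm{Mat}_P(\mathbb{C})$ generated by all $L_m,R_m$ ($1\le m\le N$) and $E^*_\mu$ ($\mu\in\{0,1\}^N$). $S_\mu=\{s:\mu_s=0\}$, $T_\mu=\{t:\mu_t=1\}$, $B_\mu=\{(s,t)\in S_\mu\times T_\mu:s<t\}$. $(\mu,\lambda)$ is admissible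 if $|\lambda\cap S_\mu|=|\lambda\cap T_\mu|=:n$ and for $1\le i\le n$ the $i$-th smallest element of $\lambda\cap S_\mu$ is less than the $i$-th smallest of $\lambda\cap T_\mu$; $\lambda$ is column-full w.r.t. $\mu$ if $T_\mu\subseteq\lambda$. $E_\lambda$: fix a basis $v_1,\ldots,v_N$ with $x_i=\mathrm{span}(v_1,\ldots,v_i)$. For $\mu$ not all zeros/ones, $\mathcal{M}_\mu(\mathbb{F}_q)$ denotes $S_\mu\times T_\mu$ matrices over $\mathbb{F}_q$ supported in $B_\mu$, and $y\in P_\mu$ has a unique matrix form $Y\in\mathcal{M}_\mu(\mathbb{F}_q)$ with $\sum_{s\in S_\mu}Y_{s,t}v_s+v_t$ ($t\in T_\mu$) a basis of $y$. For $M\in\mathcal{M}_\mu(\mathbb{F}_q)$, $(s,t)\in B_\mu$: $M(s,t)$ is the submatrix on rows $\{s'\in S_\mu:s'\le s\}$, columns $\{t'\in T_\mu:t'\ge t\}$; $s^-$ predecessor of $s$ in $S_\mu$ ($0$ if none), $t^+$ successor of $t$ in $T_\mu$ ($N+1$ if none); $r^-,r^+,r^{-+}$ are the ranks of $M(s^-,t),M(s,t^+),M(s^-,t^+)$ (each $0$ if an index is $0$ or $N+1$); $\sigma(M)=\{(s,t)\in B_\mu:r^-=r^+=r^{-+}=\mathrm{rank}\,M(s,t)-1\}$. The type of $y$ is the set of indices appearing in pairs of $\sigma(Y)$ ($\emptyset$ if $\mu$ is all zeros/ones). With a nontrivial additive character $\chi$ of $\mathbb{F}_q$: $\chi_y$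 is the indicator of $y$ if $\mu$ is all zeros/ones, otherwise $\chi_y(z)=\chi(\mathrm{tr}(YZ^T))$ for $z\in P_\mu$ (matrix form $Z$) and $0$ elsewhere. For even-size $\lambda$, $V_\lambda=\mathrm{span}\{\chi_y:y\text{ of type }\lambda\}$; $V=\bigoplus V_\lambda$, and $E_\lambda$ is the projection onto $V_\lambda$ along the other summands. *)

(* Defs.v *)
(* The field of complex numbers is R[i] for an arbitrary R : realType. *)
From HB Require Import structures.
From mathcomp Require Import all_boot all_order all_algebra.
From mathcomp Require Import reals complex.

Set Implicit Arguments.
Unset Strict Implicit.
Unset Printing Implicit Defensive.

Import Order.TTheory GRing.Theory Num.Theory.
Local Open Scope ring_scope.
Local Open Scope complex_scope.
Import VectorInternalTheory.

(* Subspaces are stored as canonical matrices, so over a finite field they form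
   a finType; this is what makes C^P a finite-dimensional space. *)
HB.instance Definition _ (F : finFieldType) (H : vectType F) :=
  [Countable of {vspace H} by <:].
HB.instance Definition _ (F : finFieldType) (H : vectType F) :=
  [Finite of {vspace H} by <:].

(* Throughout, i : 'I_N stands for the element i.+1 of {1, ..., N}. *)

Section Locations.

Variable N : nat.
Implicit Types (mu : {ffun 'I_N -> bool}) (lambda : {set 'I_N}).

Definition Sset mu : {set 'I_N} := [set s | ~~ mu s].
Definition Tset mu : {set 'I_N} := [set t | mu t].
Definition Bset mu : {set 'I_N * 'I_N} :=
  [set p | [&& p.1 \in Sset mu, p.2 \in Tset mu & (p.1 < p.2)%N]].

Definition constant_loc mu := (Sset mu == set0) || (Tset mu == set0).

(* [enum A] lists A : {set 'I_N} in increasing order, so with 0-based i the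
   value below is the (i+1)-st smallest element of A. *)
Definition nth_smallest (A : {set 'I_N}) (i : nat) : nat :=
  nth 0%N [seq val a | a <- enum A] i.

Definition admissible mu lambda : Prop :=
  #|lambda :&: Sset mu| = #|lambda :&: Tset mu| /\
  forall i : nat, (i < #|lambda :&: Sset mu|)%N ->
    (nth_smallest (lambda :&: Sset mu) i
       < nth_smallest (lambda :&: Tset mu) i)%N.

Definition column_full mu lambda : bool := Tset mu \subset lambda.

(* Predecessor in A (0 if none) and successor in A (N+1 if none); the results,
   unlike the arguments, are 1-based. *)
Definition pred_in (A : {set 'I_N}) (s : 'I_N) : nat :=
  \max_(i in A | (i < s)%N) i.+1.
Definition succ_in (A : {set 'I_N}) (t : 'I_N) : nat :=
  \big[minn/N.+1]_(i in A | (t < i)%N) i.+1.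

Section MatrixType.

Variable F : fieldType.
Implicit Types M : 'M[F]_N.

(* An S_mu x T_mu matrix supported in B_mu is represented by its extension by 0
   to an N x N matrix. *)
Definition supported_in_B mu M : bool :=
  [forall s, forall t, (M s t != 0) ==> ((s, t) \in Bset mu)].

(* Rank of the submatrix of M on the rows s' <= a and columns t' >= b, with
   1-based bounds a and b; the discarded entries are replaced by 0, which does
   not change the rank.  It is 0 when a = 0 or b = N+1. *)
Definition corner_rank M (a b : nat) : nat :=
  \rank (\matrix_(i < N, j < N)
           if ((i.+1 <= a) && (b <= j.+1))%N then M i j else 0).

(* r^- = rank M(s,t) - 1, etc., is written without truncated subtraction. *)
Definition sigma mu M : {set 'I_N * 'I_N} :=
  [set p in Bset mu |
    let s := p.1.+1 in let sm := pred_in (Sset mu) p.1 in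
    let t := p.2.+1 in let tp := succ_in (Tset mu) p.2 in
    let r := corner_rank M s t in
    [&& (corner_rank M sm t).+1 == r,
        (corner_rank M s tp).+1 == r &
        (corner_rank M sm tp).+1 == r]].

End MatrixType.

End Locations.

Inductive generated_algebra (K : fieldType) (n : nat) (G : 'M[K]_n -> Prop) :
  'M[K]_n -> Prop :=
| ga_gen A : G A -> generated_algebra G A
| ga_one : generated_algebra G 1%:M
| ga_scale a A : generated_algebra G A -> generated_algebra G (a *: A)
| ga_add A B : generated_algebra G A -> generated_algebra G B ->
    generated_algebra G (A + B)
| ga_mul A B : generated_algebra G A -> generated_algebra G B ->
    generated_algebra G (A *m B).

Section Modules.

Variables (K : fieldType) (n : nat) (A : 'M[K]_n -> Prop).
Implicit Types W U : {vspace 'cV[K]_n}.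

Definition submodule W : Prop :=
  forall a, A a -> forall w, w \in W -> a *m w \in W.

Definition irreducible_submodule W : Prop :=
  [/\ submodule W, W <> 0%VS &
      forall U, submodule U -> (U <= W)%VS -> U = 0%VS \/ U = W].

Definition generated_by W (w : 'cV[K]_n) : Prop :=
  [/\ submodule W, w \in W &
      forall U, submodule U -> w \in U -> (W <= U)%VS].

(* A linear map W -> W' is given by any extension of it to the whole space. *)
Definition module_iso W W' : Prop :=
  exists f : 'End('cV[K]_n),
    [/\ (f @: W)%VS = W', (W :&: lker f)%VS = 0%VS &
        forall a, A a -> forall w, w \in W -> f (a *m w) = a *m f w].

End Modules.

Section SubspaceLattice.

Variables (F : finFieldType) (N : nat) (H : vectType F).
Variable x : 'I_N.+1 -> {vspace H}.
Implicit Types (y z : {vspace H}) (mu : {ffun 'I_N -> bool}).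

Definition full_flag : Prop :=
  [/\ x ord0 = 0%VS, x ord_max = fullv,
      forall i j : 'I_N.+1, (i <= j)%N -> (x i <= x j)%VS &
      forall i : 'I_N.+1, \dim (x i) = i].

Definition adapted_basis (v : N.-tuple H) : Prop :=
  basis_of fullv v /\ forall i : 'I_N.+1, x i = <<take i v>>%VS.

Definition has_location y mu : bool :=
  [forall m : 'I_N.+1,
     \dim (y :&: x m) == (\sum_(i < N | (i < m)%N) mu i)%N].

(* The defaults here and in [matrix_form] are never reached when x is a full flag
   and v an adapted basis: mu and Y then exist and are unique. *)
Definition location y : {ffun 'I_N -> bool} :=
  odflt [ffun=> false] [pick mu | has_location y mu].

Definition covers (m : 'I_N) y z : bool :=
  [&& (z <= y)%VS, \dim y == (\dim z).+1 &
      [forall i, location y i == (location z i + (i == m))%N :> nat]].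

Section MatrixForm.

Variable v : N.-tuple H.

Definition is_matrix_form mu (Y : 'M[F]_N) y : bool :=
  supported_in_B mu Y &&
  basis_of y [seq \sum_(s in Sset mu) Y s t *: tnth v s + tnth v t
             | t <- enum (Tset mu)].

Definition matrix_form y : 'M[F]_N :=
  odflt 0 [pick Y | is_matrix_form (location y) Y y].

Definition subspace_type y : {set 'I_N} :=
  let mu := location y in
  if constant_loc mu then set0 else
  [set i | [exists p in sigma mu (matrix_form y), (i == p.1) || (i == p.2)]].

End MatrixForm.

Section Complex.

Variable R : realType.

Local Notation dimV := #|{: {vspace H}}|.

(* Mat_P(C) and C^P, with P enumerated by enum_val : 'I_#|P| -> P. *)
Definition matP (f : {vspace H} -> {vspace H} -> R[i]) : 'M[R[i]]_dimV :=
  \matrix_(i, j) f (enum_val i) (enum_val j).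
Definition vecP (f : {vspace H} -> R[i]) : 'cV[R[i]]_dimV :=
  \col_i f (enum_val i).

Definition Estar mu : 'M[R[i]]_dimV :=
  matP (fun y z => ((y == z) && (location y == mu))%:R).
Definition Lmx (m : 'I_N) : 'M[R[i]]_dimV :=
  matP (fun y z => (covers m z y)%:R).
Definition Rmx (m : 'I_N) : 'M[R[i]]_dimV := (Lmx m)^T.

Inductive Hgenerator : 'M[R[i]]_dimV -> Prop :=
| Hgen_L m : Hgenerator (Lmx m)
| Hgen_R m : Hgenerator (Rmx m)
| Hgen_E mu : Hgenerator (Estar mu).

Definition Halg : 'M[R[i]]_dimV -> Prop := generated_algebra Hgenerator.

Definition nontrivial_character (chi : F -> R[i]) : Prop :=
  [/\ chi 0 = 1, forall a b, chi (a + b) = chi a * chi b &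
      exists a, chi a <> 1].

Variables (v : N.-tuple H) (chi : F -> R[i]).

Definition chi_vec y : 'cV[R[i]]_dimV :=
  if constant_loc (location y) then vecP (fun z => (z == y)%:R) else
  vecP (fun z => if location z == location y
                 then chi (\tr (matrix_form v y *m (matrix_form v z)^T))
                 else 0).

Definition Vtype (lambda : {set 'I_N}) : {vspace 'cV[R[i]]_dimV} :=
  <<[seq chi_vec y | y in [pred y | subspace_type v y == lambda]]>>%VS.

(* Meaningful for #|lambda| even: the projection onto Vtype lambda along the
   sum of the other summands of the decomposition of C^P. *)
Definition Eproj (lambda : {set 'I_N}) : 'End('cV[R[i]]_dimV) :=
  daddv_pi (Vtype lambda)
    (\sum_(k : {set 'I_N} | ~~ odd #|k| && (k != lambda)) Vtype k)%VS.

Definition parametrized_by (W : {vspace 'cV[R[i]]_dimV})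
    mu (lambda : {set 'I_N}) : Prop :=
  [/\ admissible mu lambda, column_full mu lambda &
      exists u : 'cV[R[i]]_dimV,
        Estar mu *m Eproj lambda u <> 0 /\
        generated_by Halg W (Estar mu *m Eproj lambda u)].

End Complex.

End SubspaceLattice.

Arguments Halg {F N H} x R _.

(* Main.v *)
(** In matrix coordinates [L_m R_m] and [R_m L_m] act on functions on [P_mu] as
    convolutions with rank one matrices, so the characters [chi_y] diagonalize
    them and the eigenvalues count solutions of linear systems. For [m] in
    [T_mu] the eigenvalue of [R_m L_m] on [chi_y] vanishes iff [m] belongs to
    the type of [y]; for [m] in [S_mu] the same holds for [L_m R_m], whose
    eigenvalue moreover depends only on [mu], [m] and the type.

    Hence, if [lambda] is column-full, every [L_m] kills the block
    [E*_mu E_lambda V], and [L_m R_m] acts on it by a scalar. As [R_m R_n] is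
    proportional to [R_n R_m] and [L_m R_n = R_n L_m] for [m <> n], an element
    [h] of the algebra maps a vector [u] of the block to a combination of the
    vectors [R_m1 ... R_mk u] whose coefficients do not depend on [u]. In
    particular [E*_mu h u = c(h) u], so [|h u|^2 = c(h^* h) |u|^2], and
    [h u |-> h u'] is a well-defined isomorphism for any nonzero [u, u'] in the
    block; moreover [C u] is the part of lowest dimension of the module
    generated by [u], which recovers [mu] and [lambda].

    Conversely a component of lowest dimension of an irreducible module is
    killed by all [L_m], hence is a sum of vectors from column-full blocks, and
    a product of operators [L_m R_m] isolates one of them. *)

Require Import Defs.
From mathcomp Require Import boolp.
From mathcomp Require Import all_boot all_order all_algebra.
From mathcomp Require Import reals complex.
From mathcomp Require Import mxabelem zify ring.

Set Implicit Arguments.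
Unset Strict Implicit.
Unset Printing Implicit Defensive.

Import Order.TTheory GRing.Theory Num.Theory.
Local Open Scope ring_scope.
Local Open Scope complex_scope.

(** * Ranks of corner submatrices and types *)

(** The link between types and eigenvalues is a matter of corner ranks. These are submodular, so the
    pairs of [sigma] form a partial matching of rows and columns, and whether an index occurs in it
    is a single linear independence condition. The same condition governs the solvability of the
    linear system behind the eigenvalue at that index. That a nonzero [theta_row] depends on the
    type alone is less evident, since the type forgets how rows and columns are matched. This
    eigenvalue is a power of [q] in which the matrix enters only through the rank of the corner
    strictly above and to the right of the diagonal position [m]. That rank counts the matched pairs
    [(s, t)] with [s < m < t]. Every pair has [s < t], so the count is the number of rows of the
    type below [m] minus the number of columns below [m]. The factor between [R_m R_n] and [R_n R_m]
    is [q] or its inverse: the entry at [(m, n)] of the intermediate matrix is free when [m < n] and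
    is forced to vanish otherwise. *)

Section RankProfile.
Variables (F : fieldType) (N : nat).
Implicit Types M : 'M[F]_N.

(* 0-based: the rank of [M] on the rows [i < a] and the columns [j >= b]. *)
Definition rho M a b := corner_rank M a b.+1.
(** Row [s], cut to the columns [j >= b], is not a combination of the rows above it. [col_jump] is
    the mirror image, with the columns to the right of [t]. *)
Definition row_jump M s b := (rho M s b < rho M s.+1 b)%N.
Definition col_jump M a t := (rho M a t.+1 < rho M a t)%N.

Definition lowmx a : 'M[F]_N := diag_mx (\row_i (i < a)%N%:R).
Definition highmx b : 'M[F]_N := diag_mx (\row_j (b <= j)%N%:R).

Lemma lowmx_mul n a (M : 'M[F]_(N, n)) : lowmx a *m M =
  \matrix_(i, j) if (i < a)%N then M i j else 0.
Proof.
by apply/matrixP=> i j; rewrite mul_diag_mx !mxE; case: ifP; rewrite ?mul1r ?mul0r.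
Qed.

Lemma mul_highmx n b (M : 'M[F]_(n, N)) : M *m highmx b =
  \matrix_(i, j) if (b <= j)%N then M i j else 0.
Proof.
by apply/matrixP=> i j; rewrite mul_mx_diag !mxE; case: ifP; rewrite ?mulr1 ?mulr0.
Qed.

Lemma rho_mul M a b : rho M a b = \rank (lowmx a *m M *m highmx b).
Proof.
rewrite /rho /corner_rank; congr (\rank _).
rewrite lowmx_mul mul_highmx; apply/matrixP=> i j; rewrite !mxE ltnS.
by case: (i < a)%N; case: (b <= j)%N.
Qed.

Lemma lowmx_low M a a' : (a <= a')%N -> lowmx a *m (lowmx a' *m M) = lowmx a *m M.
Proof.
move=> le_aa'; rewrite !lowmx_mul; apply/matrixP=> i j; rewrite !mxE.
by case: ifP => // lt_ia; rewrite (leq_trans lt_ia).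
Qed.

Lemma highmx_high M b b' : (b <= b')%N -> M *m highmx b *m highmx b' = M *m highmx b'.
Proof.
move=> le_bb'; rewrite !mul_highmx; apply/matrixP=> i j; rewrite !mxE.
by case: ifP => // lt_ia; rewrite (leq_trans le_bb').
Qed.

(* Frobenius' rank inequality. *)
Lemma rho_submod M a a' b b' : (a <= a')%N -> (b <= b')%N ->
  (rho M a b + rho M a' b' <= rho M a' b + rho M a b')%N.
Proof.
move=> le_a le_b.
have := mxrank_Frobenius (lowmx a) (lowmx a' *m M *m highmx b) (highmx b').
have -> : lowmx a *m (lowmx a' *m M *m highmx b) = lowmx a *m M *m highmx b.
  by rewrite -(mulmxA (lowmx a')) lowmx_low // mulmxA.
by rewrite !highmx_high // -!rho_mul addnC [X in (_ <= X)%N]addnC addnC.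
Qed.

Lemma rho0l M b : rho M 0 b = 0%N.
Proof. by rewrite rho_mul lowmx_mul; apply/eqP;
  rewrite -leqn0 (leq_trans (mxrankM_maxl _ _)) // leqn0 mxrank_eq0; apply/eqP/matrixP=> i j;
    rewrite !mxE ltn0. Qed.

Lemma rho_max M a : rho M a N = 0%N.
Proof. by rewrite rho_mul mul_highmx; apply/eqP; rewrite mxrank_eq0; apply/eqP/matrixP=> i j;
  rewrite !mxE leqNgt ltn_ord. Qed.

Lemma rho_leSr M a b : (rho M a b.+1 <= rho M a b)%N.
Proof. have := @rho_submod M 0 a b b.+1 isT (leqnSn b); rewrite !rho0l; lia. Qed.

Lemma rho_leSl M a (b : 'I_N) : (rho M a b <= rho M a.+1 b)%N.
Proof. by have := @rho_submod M a a.+1 b N (leqnSn a) (ltnW (ltn_ord b)); rewrite !rho_max;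
  lia. Qed.

Lemma rho_leSSl M (a : 'I_N) b : (rho M a.+1 b <= (rho M a b).+1)%N.
Proof.
rewrite !rho_mul.
have -> : lowmx a.+1 = lowmx a + delta_mx a a.
  apply/matrixP=> i j; rewrite !mxE ltnS leq_eqVlt.
  case: (eqVneq i j) => [<-|neq_ij]; last first.
    have eqF : (i == a) && (j == a) = false.
      by apply/negP=> /andP[/eqP ia /eqP ja]; rewrite ia ja eqxx in neq_ij.
    by rewrite eqF !mulr0n add0r.
  rewrite !mulr1n -val_eqE andbb; case: ltngtP => _ /=; by rewrite ?addr0 ?add0r.
rewrite !mulmxDl (leq_trans (mxrank_add _ _)) // -[X in (_ <= X)%N]addn1 leq_add2l.
by rewrite -mulmxA (leq_trans (mxrankM_maxl _ _)) // mxrank_delta.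
Qed.

Lemma rho_leSSr M a (b : 'I_N) : (rho M a b <= (rho M a b.+1).+1)%N.
Proof.
rewrite !rho_mul.
have -> : highmx b = highmx b.+1 + delta_mx b b.
  apply/matrixP=> i j; rewrite !mxE [(b <= _)%N]leq_eqVlt.
  case: (eqVneq i j) => [<-|neq_ij]; last first.
    have eqF : (i == b) && (j == b) = false.
      by apply/negP=> /andP[/eqP ia /eqP ja]; rewrite ia ja eqxx in neq_ij.
    by rewrite eqF !mulr0n add0r.
  rewrite !mulr1n -val_eqE andbb; case: ltngtP => _ /=; by rewrite ?addr0 ?add0r.
rewrite !mulmxDr (leq_trans (mxrank_add _ _)) // -[X in (_ <= X)%N]addn1 leq_add2l.
by rewrite (leq_trans (mxrankM_maxr _ _)) // mxrank_delta.
Qed.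

(** By submodularity a row that is independent of those above it remains so when columns are
    added. *)
Lemma row_jumpW M s b b' : (b <= b')%N -> row_jump M s b' -> row_jump M s b.
Proof. by move=> le_b; have := @rho_submod M s s.+1 b b' (leqnSn s) le_b; rewrite /row_jump;
  lia. Qed.

Lemma col_jumpW M a a' t : (a <= a')%N -> col_jump M a t -> col_jump M a' t.
Proof. by move=> le_a; have := @rho_submod M a a' t t.+1 le_a (leqnSn t); rewrite /col_jump;
  lia. Qed.

(** [t] is the last column bound at which row [s] still jumps. By [pivotE] this is the rank
    condition of [sigma] with predecessor and successor replaced by the neighbouring indices; that
    condition is symmetric in rows and columns, whence [pivot_col]. *)
Definition pivot M s t := row_jump M s t && ~~ row_jump M s t.+1.

Lemma pivotE M (s t : 'I_N) : pivot M s t =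
  [&& (rho M s t).+1 == rho M s.+1 t, (rho M s.+1 t.+1).+1 == rho M s.+1 t
    & (rho M s t.+1).+1 == rho M s.+1 t].
Proof.
rewrite /pivot /row_jump.
have := rho_leSl M s t; have := rho_leSr M s t; have := rho_leSr M s.+1 t.
have := rho_leSSl M s t; have := rho_leSSr M s t; have := rho_leSSr M s.+1 t.
have := rho_leSSl M s t.+1.
have : (rho M s t.+1 <= rho M s.+1 t.+1)%N.
  by have := @rho_submod M s s.+1 t.+1 N (leqnSn s) (ltn_ord t); rewrite !rho_max; lia.
have := @rho_submod M s s.+1 t t.+1 (leqnSn s) (leqnSn t).
lia.
Qed.

Lemma pivot_col M (s t : 'I_N) : pivot M s t = col_jump M s.+1 t && ~~ col_jump M s t.
Proof.
rewrite pivotE /col_jump.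
have := rho_leSl M s t; have := rho_leSr M s t; have := rho_leSr M s.+1 t.
have := rho_leSSl M s t; have := rho_leSSr M s t; have := rho_leSSr M s.+1 t.
have := rho_leSSl M s t.+1.
have : (rho M s t.+1 <= rho M s.+1 t.+1)%N.
  by have := @rho_submod M s s.+1 t.+1 N (leqnSn s) (ltn_ord t); rewrite !rho_max; lia.
have := @rho_submod M s s.+1 t t.+1 (leqnSn s) (leqnSn t).
lia.
Qed.

Lemma pivot_injr M (s t t' : 'I_N) : pivot M s t -> pivot M s t' -> t = t'.
Proof.
case/andP=> h1 /negP h2 /andP[h1' /negP h2']; apply/val_inj; case: (ltngtP t t') => // lt.
  by case: h2; apply: row_jumpW h1'.
by case: h2'; apply: row_jumpW h1.
Qed.

Lemma pivot_injl M (s s' t : 'I_N) : pivot M s t -> pivot M s' t -> s = s'.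
Proof.
rewrite !pivot_col; case/andP=> h1 /negP h2 /andP[h1' /negP h2'].
apply/val_inj; case: (ltngtP s s') => // lt.
  by case: h2'; apply: col_jumpW h1.
by case: h2; apply: col_jumpW h1'.
Qed.

(** The largest bound at which row [s] jumps is its pivot column; it is less than [N] because all
    ranks vanish at the bound [N]. *)
Lemma row_jump_pivot M (s : 'I_N) b : row_jump M s b ->
  exists2 t : 'I_N, (b <= t)%N & pivot M s t.
Proof.
move=> jb; have leN : forall i, row_jump M s i -> (i <= N)%N.
  move=> i; rewrite leqNgt; apply: contraL => lt_Ni.
  rewrite -leqNgt; have := @rho_submod M s s.+1 N i (leqnSn s) (ltnW lt_Ni); rewrite !rho_max;
    lia.
have [t jt tmax] := ex_maxnP (ex_intro _ b jb) leN.
have ltN : (t < N)%N.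
  rewrite ltn_neqAle leN // andbT; apply/eqP=> tN; move: jt; rewrite /row_jump tN !rho_max //.
exists (Ordinal ltN); first exact: tmax.
by rewrite /pivot jt; apply/negP=> /tmax; rewrite ltnn.
Qed.

Lemma col_jump_pivot M a (t : 'I_N) : (a <= N)%N -> col_jump M a t ->
  exists2 s : 'I_N, (s < a)%N & pivot M s t.
Proof.
move=> leN ja; have [[|s] js smin] := ex_minnP (ex_intro (fun a => col_jump M a t) a ja).
  by move: js; rewrite /col_jump !rho0l.
have lt_sa : (s < a)%N by exact: smin.
have ltN : (s < N)%N by exact: leq_trans leN.
exists (Ordinal ltN) => //; rewrite pivot_col js /=; apply/negP=> /smin; by rewrite ltnn.
Qed.

Lemma row0_jump M (s : 'I_N) b : (forall j, M s j = 0) -> row_jump M s b = false.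
Proof.
move=> M0; rewrite /row_jump !rho_mul; suff -> : lowmx s *m M = lowmx s.+1 *m M by rewrite ltnn.
rewrite !lowmx_mul; apply/matrixP=> i j; rewrite !mxE ltnS [(i <= s)%N]leq_eqVlt.
by case: eqP => //= /val_inj ->; rewrite M0 if_same.
Qed.

Lemma col0_jump M a (t : 'I_N) : (forall i, M i t = 0) -> col_jump M a t = false.
Proof.
move=> M0; rewrite /col_jump !rho_mul -!mulmxA.
suff -> : M *m highmx t.+1 = M *m highmx t by rewrite ltnn.
rewrite !mul_highmx; apply/matrixP=> i j; rewrite !mxE [(t <= j)%N]leq_eqVlt.
by case: eqP => //= /val_inj <-; rewrite M0 if_same.
Qed.

Lemma rho_sum M a b : (b <= N)%N -> (a <= N)%N ->
  rho M a b = (\sum_(s < N | s < a) (row_jump M s b : nat))%N.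
Proof.
move=> leb; elim: a => [|a IH] lea; first by rewrite rho0l big_pred0.
rewrite (bigD1 (Ordinal lea)) //= (eq_bigl (fun i : 'I_N => (i < a)%N)); last first.
  by move=> i; rewrite -val_eqE /=; lia.
rewrite -IH; last exact: ltnW.
have := rho_leSSl M (Ordinal lea) b; rewrite /row_jump /=.
have : (rho M a b <= rho M a.+1 b)%N.
  by have := @rho_submod M a a.+1 b N (leqnSn a) leb; rewrite !rho_max; lia.
by case: ltnP => /=; lia.
Qed.

End RankProfile.

(** [pred_in] is 1-based and [i] is 0-based, so the left side says that row [i] is kept when the
    rows are cut at the predecessor of [s]. *)
Lemma ltn_pred_in N (A : {set 'I_N}) (s i : 'I_N) : i \in A -> (i < pred_in A s)%N = (i < s)%N.
Proof.
move=> iA; apply/idP/idP => [lt|lt]; last first.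
  by rewrite /pred_in (bigD1 i) /= ?iA // leq_max ltnSn.
by apply: leq_trans lt _; apply/bigmax_leqP=> j /andP[].
Qed.

Lemma succ_in_leq N (A : {set 'I_N}) (t j : 'I_N) : j \in A ->
  (succ_in A t <= j.+1)%N = (t < j)%N.
Proof.
move=> jA; apply/idP/idP => [le|lt]; last first.
  rewrite /succ_in unlock /=; have := mem_index_enum j; elim: (index_enum _) => //= i r IH.
rewrite inE => /orP[/eqP <-|/IH le]; first by rewrite jA lt geq_min leqnn.
by case: ifP => // _; rewrite geq_min le orbT.
suff h : (t.+2 <= succ_in A t)%N by have := leq_trans h le.
rewrite /succ_in; elim/big_ind: _ => [|y z|i /andP[]] //; first exact: ltn_ord.
by rewrite leq_min => -> ->.
Qed.

Lemma nth_lt_count (s : seq nat) k i : sorted ltn s -> (i < size s)%N ->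
  (nth 0%N s i < k)%N = (i < count (fun a => a < k)%N s)%N.
Proof.
elim: s i => //= x s IH i pxs lti; have [lt|le] := ltnP x k.
  by case: i lti => [|i] lti //=; rewrite add1n ltnS IH //; apply: path_sorted pxs.
have /allP xs := order_path_min ltn_trans pxs.
rewrite [X in (0 + X)%N](_ : _ = 0)%N ?ltn0; last first.
  by apply/eqP; rewrite -leqn0 leqNgt -has_count; apply/hasPn=> y /xs lt;
    rewrite -leqNgt (leq_trans le) // ltnW.
rewrite ltnNge; case: i lti => [|i] lti /=; first by rewrite le.
by rewrite (leq_trans le) // ltnW // xs // mem_nth.
Qed.

(** Turns the order statistics in [admissible] into cardinals: in an increasing list the entry of
    index [i] is below [k] exactly when more than [i] entries are. *)
Lemma nth_smallest_lt N (A : {set 'I_N}) k i : (i < #|A|)%N ->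
  (nth_smallest A i < k)%N = (i < #|[set a in A | (a < k)%N]|)%N.
Proof.
move=> lti; rewrite /nth_smallest nth_lt_count ?size_map -?cardE //.
  rewrite count_map cardE -size_filter; congr (_ < _)%N.
  rewrite /enum_mem -filter_predI.
  by congr size; apply: eq_filter => x; rewrite /= inE andbC.
rewrite sorted_map /=; apply: sorted_filter; first by move=> y x z; apply: ltn_trans.
by rewrite -(sorted_map (e' := ltn)) -enumT val_enum_ord iota_ltn_sorted.
Qed.

(** * The type of a supported matrix in terms of jumps and pivots *)

Section TypeOfMatrix.
Variables (F : fieldType) (N : nat) (mu : {ffun 'I_N -> bool}) (M : 'M[F]_N).
Hypothesis suppM : supported_in_B mu M.

Lemma supportedP s t : M s t != 0 -> [/\ ~~ mu s, mu t & (s < t)%N].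
Proof.
move=> nz; have /forallP/(_ s)/forallP/(_ t)/implyP/(_ nz) := suppM.
by rewrite !inE => /and3P[].
Qed.

Lemma supported0 s t : ~~ [&& ~~ mu s, mu t & (s < t)%N] -> M s t = 0.
Proof. by apply: contraNeq => /supportedP[-> -> ->]. Qed.

Definition matrix_type : {set 'I_N} :=
  [set i | [exists p in sigma mu M, (i == p.1) || (i == p.2)]].

(** The rows between [s] and its predecessor in [S_mu] are indexed by [T_mu], hence zero, and
    likewise for columns. Cutting at the neighbouring index therefore gives the same ranks. *)
Lemma sigmaE (s t : 'I_N) :
  ((s, t) \in sigma mu M) = [&& ~~ mu s, mu t, (s < t)%N & pivot M s t].
Proof.
have predE b : corner_rank M (pred_in (Sset mu) s) b.+1 = rho M s b.
  congr (\rank _); apply/matrixP=> i j; rewrite !mxE /=.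
  have [->|/supportedP[mui _ _]] := eqVneq (M i j) 0; first by rewrite !if_same.
  by rewrite ltn_pred_in // inE.
have succE a : corner_rank M a (succ_in (Tset mu) t) = rho M a t.+1.
  congr (\rank _); apply/matrixP=> i j; rewrite !mxE /=.
  have [->|/supportedP[_ muj _]] := eqVneq (M i j) 0; first by rewrite !if_same.
  by rewrite succ_in_leq // inE.
have predsuccE : corner_rank M (pred_in (Sset mu) s) (succ_in (Tset mu) t) = rho M s t.+1.
  congr (\rank _); apply/matrixP=> i j; rewrite !mxE /=.
  have [->|/supportedP[mui muj _]] := eqVneq (M i j) 0; first by rewrite !if_same.
  by rewrite ltn_pred_in ?succ_in_leq // inE.
rewrite inE /= predE succE predsuccE !inE /= -!andbA; do 3 congr (_ && _).
by rewrite pivotE.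
Qed.

Lemma row_jump_loc (s : 'I_N) b : row_jump M s b -> ~~ mu s.
Proof.
by apply: contraTN => mus; rewrite row0_jump // => j; rewrite supported0 // mus.
Qed.

Lemma col_jump_loc a (t : 'I_N) : col_jump M a t -> mu t.
Proof.
by apply: contraTT => mut; rewrite col0_jump // => j; rewrite supported0 // (negPf mut) andbF.
Qed.

Lemma pivot_sigma (s t : 'I_N) : pivot M s t -> (s < t)%N -> (s, t) \in sigma mu M.
Proof.
move=> pst lt; rewrite sigmaE lt pst (@row_jump_loc _ t) ?(@col_jump_loc s.+1) //.
  by move: pst; rewrite pivot_col => /andP[].
by case/andP: pst.
Qed.

(** A jump on the columns after [m] yields a pivot [(m, t)] with [t > m], so a pair of [sigma].
    Conversely such a jump persists down to the bound [m.+1]. *)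
Lemma mem_type_row (m : 'I_N) : ~~ mu m -> (m \in matrix_type) = row_jump M m m.+1.
Proof.
move=> mum; rewrite inE; apply/exists_inP/idP.
  case=> -[s t]; rewrite sigmaE => /and4P[_ mut lt pst] /= /orP[] /eqP me;
    last by rewrite me mut in mum.
  by rewrite me; case/andP: pst => + _; apply: row_jumpW.
case/row_jump_pivot=> t lt pmt; exists (m, t); first exact: pivot_sigma.
by rewrite eqxx.
Qed.

Lemma mem_type_col (m : 'I_N) : mu m -> (m \in matrix_type) = col_jump M m m.
Proof.
move=> mum; rewrite inE; apply/exists_inP/idP.
  case=> -[s t]; rewrite sigmaE => /and4P[mus _ lt pst] /= /orP[] /eqP me;
    first by rewrite -me mum in mus.
  by rewrite me; move: pst; rewrite pivot_col => /andP[+ _]; apply: col_jumpW.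
case/(col_jump_pivot (ltnW (ltn_ord m)))=> s lt psm.
exists (s, m); first exact: pivot_sigma.
by rewrite eqxx orbT.
Qed.

Lemma sigma_injl : {in sigma mu M &, injective fst}.
Proof.
move=> [s t] [s' t']; rewrite !sigmaE => /and4P[_ _ _ p] /and4P[_ _ _ p'] /= ss'.
by move: p'; rewrite -ss' => p'; rewrite (pivot_injr p p').
Qed.

Lemma sigma_injr : {in sigma mu M &, injective snd}.
Proof.
move=> [s t] [s' t']; rewrite !sigmaE => /and4P[_ _ _ p] /and4P[_ _ _ p'] /= ss'.
by move: p'; rewrite -ss' => p'; rewrite (pivot_injl p p').
Qed.

(** No two pairs of [sigma] share a row or a column, so counting rows of the type amounts to
    counting pairs. *)
Lemma card_sigma_fst (P : pred 'I_N) :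
  #|[set s in matrix_type :&: Sset mu | P s]| = #|[set p in sigma mu M | P p.1]|.
Proof.
rewrite -(card_in_imset (f := fst)); last first.
  by move=> p q /setIdP[+ _] /setIdP[+ _]; apply: sigma_injl.
apply: eq_card => s; rewrite inE; apply/idP/imsetP.
  case/andP; rewrite !inE => /andP[/exists_inP[[s' t]]] st /= eqs mus Ps.
  have := st; rewrite sigmaE => /and4P[_ mut _ _].
  case/orP: eqs => /eqP es; last by rewrite es mut in mus.
  by exists (s', t); rewrite //= inE st /= -es.
case=> -[s' t] /setIdP[st] /= Ps ->; rewrite Ps andbT !inE.
have := st; rewrite sigmaE => /and4P[-> _ _ _]; rewrite andbT.
by apply/exists_inP; exists (s', t) => //=; rewrite eqxx.
Qed.

Lemma card_sigma_snd (P : pred 'I_N) :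
  #|[set t in matrix_type :&: Tset mu | P t]| = #|[set p in sigma mu M | P p.2]|.
Proof.
rewrite -(card_in_imset (f := snd)); last first.
  by move=> p q /setIdP[+ _] /setIdP[+ _]; apply: sigma_injr.
apply: eq_card => t; rewrite inE; apply/idP/imsetP.
  case/andP; rewrite !inE => /andP[/exists_inP[[s t']]] st /= eqt mut Pt.
  have := st; rewrite sigmaE => /and4P[mus _ _ _].
  case/orP: eqt => /eqP et; first by rewrite -et mut in mus.
  by exists (s, t'); rewrite //= inE st /= -et.
case=> -[s t'] /setIdP[st] /= Pt ->; rewrite Pt andbT !inE.
have := st; rewrite sigmaE => /and4P[_ -> _ _]; rewrite andbT.
by apply/exists_inP; exists (s, t') => //=; rewrite eqxx orbT.
Qed.

(** The rank counts the pairs [(s, t)] with [s < m < t]. The remaining pairs with [s < m] have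
    [t < m], as [m] is not a column, and every pair with [t < m] is among them because [s < t].
    Hence the rank is a function of [mu], [m] and the type. *)
Lemma rho_type (m : 'I_N) : ~~ mu m ->
  (rho M m m.+1 + #|[set t in matrix_type :&: Tset mu | (t < m)%N]|
   = #|[set s in matrix_type :&: Sset mu | (s < m)%N]|)%N.
Proof.
move=> mum; rewrite card_sigma_fst card_sigma_snd rho_sum //; last exact: ltnW.
rewrite -(cardsID [set p : 'I_N * 'I_N | (m < p.2)%N] [set p in sigma mu M | (p.1 < m)%N]).
congr (_ + _)%N; last first.
  apply: eq_card => -[s t]; apply/setIdP/setDP => /=.
    case=> st lt; split; last by rewrite inE -leqNgt ltnW.
    apply/setIdP; split=> //=; move: st; rewrite sigmaE => /and4P[_ _ lt_st _].
    exact: ltn_trans lt_st lt.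
  case=> /setIdP[st /= lt]; rewrite inE -leqNgt => le; split=> //; rewrite ltn_neqAle le andbT.
  by apply: contra mum => /eqP/val_inj <-; move: st; rewrite sigmaE => /and4P[].
rewrite -(card_in_imset (f := fst)); last first.
  by move=> p q /setIP[/setIdP[+ _] _] /setIP[/setIdP[+ _] _]; apply: sigma_injl.
have -> : (\sum_(s < N | s < m) row_jump M s m.+1)%N = #|[set s : 'I_N | (s < m)%N && row_jump M
  s m.+1]|.
  rewrite -sum1_card [LHS]big_mkcond [RHS]big_mkcond; apply: eq_bigr => s _; rewrite inE.
  by case: (s < m)%N => //; case: row_jump.
apply: eq_card => s; rewrite inE; apply/andP/imsetP.
  case=> lt /row_jump_pivot[t lt' pst]; exists (s, t) => //.
  by apply/setIP; split; [apply/setIdP; rewrite pivot_sigma // (ltn_trans lt lt')|rewrite inE].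
case=> -[s' t] /setIP[/setIdP[+ /= lt]]; rewrite sigmaE inE => /and4P[_ _ _ /andP[p _]] /= lt' ->.
by split=> //; apply: row_jumpW p.
Qed.

Lemma admissible_type : admissible mu matrix_type.
Proof.
have cardE A (P : pred 'I_N) : #|A :&: [set x | P x]| = #|[set x in A | P x]| by rewrite setIdE.
have eq_n : #|matrix_type :&: Sset mu| = #|matrix_type :&: Tset mu|.
  have := card_sigma_fst predT; have := card_sigma_snd predT.
  by rewrite !setIdE !setIT => -> ->.
split=> // i lti; rewrite nth_smallest_lt // card_sigma_fst.
(* More than [i] pairs have their column at most [k], and the row of each of these is strictly below
   [k]. *)
set k := nth_smallest _ _.
have : (i < #|[set t in matrix_type :&: Tset mu | (t < k.+1)%N]|)%N.
  by rewrite -nth_smallest_lt -?eq_n // ltnS.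
rewrite card_sigma_snd => /leq_trans; apply; apply/subset_leq_card/subsetP => -[s t].
case/setIdP=> st /= lt; apply/setIdP; split=> //=.
by move: st; rewrite sigmaE => /and4P[_ _ /leq_trans-> //].
Qed.

End TypeOfMatrix.

(** * Character sums *)

Section Support.
Variables (F : fieldType) (m n : nat) (Q : 'I_m -> 'I_n -> bool).
Implicit Types X : 'M[F]_(m, n).

Definition supp X := [forall i, forall j, (X i j != 0) ==> Q i j].

Lemma suppP X : reflect (forall i j, X i j != 0 -> Q i j) (supp X).
Proof. by apply: (iffP 'forall_forallP) => h i j; apply/implyP; apply: h. Qed.

Lemma supp0E X i j : supp X -> ~~ Q i j -> X i j = 0.
Proof. by move=> /suppP h; apply: contraNeq => /h. Qed.

Lemma suppD X Y : supp X -> supp Y -> supp (X + Y).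
Proof.
move=> sX sY; apply/suppP=> i j; apply: contraR => nq.
by rewrite mxE !(@supp0E _ i j) // addr0.
Qed.

Lemma suppN X : supp X -> supp (- X).
Proof.
by move=> sX; apply/suppP=> i j; apply: contraR => nq; rewrite mxE (supp0E sX) // oppr0.
Qed.

Lemma suppB X Y : supp X -> supp Y -> supp (X - Y).
Proof. by move=> sX sY; apply: suppD => //; apply: suppN. Qed.

Lemma suppDr X Y : supp Y -> supp (X + Y) = supp X.
Proof.
move=> sY; apply/idP/idP => [h|/suppD]; last exact.
by rewrite -(addrK Y X); apply: suppB.
Qed.

End Support.

Section CharSum.
Variables (F : finFieldType) (C : numFieldType) (chi : F -> C).
Hypothesis chi0 : chi 0 = 1.
Hypothesis chiD : forall a b, chi (a + b) = chi a * chi b.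
Hypothesis chi_nt : exists a, chi a <> 1.

Lemma trace_delta m n (A : 'M[F]_(m, n)) a i j : \tr (A *m (a *: delta_mx i j)^T) = a * A i j.
Proof.
rewrite linearZ /= -scalemxAr linearZ /= trmx_delta; congr (_ * _).
rewrite mxtrace_mulC /mxtrace (bigD1 j) //= mxE (bigD1 i) //= !mxE !eqxx mul1r.
rewrite [X in _ + X + _]big1 => [|k ki]; last by rewrite !mxE (negPf ki) andbF mul0r.
rewrite addr0 big1 ?addr0 // => k kj; rewrite mxE big1 // => l _.
by rewrite !mxE (negPf kj) mul0r.
Qed.

Lemma char_sum m n (Q : 'I_m -> 'I_n -> bool) (A : 'M[F]_(m, n)) :
  \sum_(X | supp Q X) chi (\tr (A *m X^T)) =
  if [forall i, forall j, Q i j ==> (A i j == 0)] then #|[pred X : 'M[F]_(m,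
    n) | supp Q X]|%:R else 0.
Proof.
case: ifP => [/'forall_forallP A0|/negbT].
  rewrite (eq_bigr (fun _ => 1)) => [|X sX]; first by rewrite sumr_const.
  rewrite /mxtrace big1 => [|i _]; first exact: chi0.
  rewrite mxE big1 // => j _; rewrite mxE; have /implyP := A0 i j.
  by case: (boolP (Q i j)) => [_ /(_ isT)/eqP ->|nq _]; rewrite ?mul0r // (supp0E sX) ?mulr0.
case/forallPn=> i /forallPn[j].
rewrite negb_imply => /andP[Qij nz]; have [a chia] := chi_nt.
(* [X0] pairs with [A] to the value [a], where [chi a] differs from 1. Translating the summation by
   [X0] multiplies the sum by [chi a], so the sum vanishes. *)
pose X0 : 'M[F]_(m, n) := (a / A i j) *: delta_mx i j.
have sX0 : supp Q X0.
  apply/suppP=> k l; rewrite !mxE; case: (altP (k =P i)) => [->|_]; last by rewrite mulr0 eqxx.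
  by case: (altP (l =P j)) => [->|_] //; rewrite mulr0 eqxx.
set S := LHS; have : S = chi a * S.
  rewrite {1}/S (reindex_inj (addIr X0)) /= /S big_distrr /=; apply: eq_big => [X|X _].
    by rewrite suppDr.
  by rewrite linearD /= mulmxDr linearD /= trace_delta divfK // chiD mulrC.
move/eqP; rewrite -subr_eq0 -{1}[S]mul1r -mulrBl mulf_eq0 subr_eq0 eq_sym.
by case/orP=> /eqP.
Qed.

End CharSum.

Lemma rank_extra_row (F : fieldType) (p n : nat) (B B' : 'M[F]_(p, n)) (m : 'I_p) :
  (forall i, i != m -> row i B = row i B') -> row m B = 0 ->
  (\rank B < \rank B')%N = ~~ (row m B' <= B)%MS.
Proof.
move=> eqB Bm.
have sBB' : (B <= B')%MS.
  apply/row_subP=> i; have [->|/eqB ->] := eqVneq i m; first by rewrite Bm sub0mx.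
  exact: row_sub.
rewrite ltn_neqAle (mxrank_leqif_sup sBB').1 andbT (mxrank_leqif_sup sBB').2.
congr (~~ _); apply/idP/idP => [|h]; first exact: submx_trans (row_sub _ _).
apply/row_subP=> i; have [->//|/eqB <-] := eqVneq i m; exact: row_sub.
Qed.

Lemma row_jump_sub (F : fieldType) N (A : 'M[F]_N) (m : 'I_N) b :
  row_jump A m b = ~~ (row m (A *m highmx F N b) <= lowmx F N m *m A *m highmx F N b)%MS.
Proof.
rewrite /row_jump !rho_mul -!mulmxA (@rank_extra_row _ _ _ _ _ m).
- congr (~~ (_ <= _)%MS); apply/rowP=> j; rewrite lowmx_mul [LHS]mxE [LHS]mxE ltnSn.
  by rewrite [RHS]mxE.
- move=> i; rewrite -val_eqE /= => im; apply/rowP=> j; rewrite !lowmx_mul.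
  by rewrite mxE [LHS]mxE [RHS]mxE [RHS]mxE ltnS [(i <= m)%N]leq_eqVlt (negPf im).
by apply/rowP=> j; rewrite lowmx_mul mxE mxE ltnn mxE.
Qed.

Lemma col_jump_sub (F : fieldType) N (A : 'M[F]_N) a (m : 'I_N) :
  col_jump A a m = ~~ ((col m (lowmx F N a *m A))^T <= (lowmx F N a *m A *m highmx F N
    m.+1)^T)%MS.
Proof.
rewrite /col_jump !rho_mul -mxrank_tr -[X in (_ < X)%N]mxrank_tr (@rank_extra_row _ _ _ _ _ m).
- congr (~~ (_ <= _)%MS); apply/rowP=> j; rewrite mul_highmx.
  by rewrite [LHS]mxE [LHS]mxE [LHS]mxE leqnn [RHS]mxE [RHS]mxE.
- move=> i; rewrite -val_eqE /= => im; apply/rowP=> j; rewrite !mul_highmx.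
  by rewrite mxE [LHS]mxE [LHS]mxE [RHS]mxE [RHS]mxE [RHS]mxE [(m <= i)%N]leq_eqVlt eq_sym
    (negPf im).
by apply/rowP=> j; rewrite mul_highmx mxE mxE mxE ltnn mxE.
Qed.

(** * Eigenvalues as numbers of solutions of linear systems *)

Section Theta.
Variables (F : finFieldType) (N : nat) (C : numFieldType) (chi : F -> C).
Hypothesis chi0 : chi 0 = 1.
Hypothesis chiD : forall a b, chi (a + b) = chi a * chi b.
Hypothesis chi_nt : exists a, chi a <> 1.
Variables (mu : {ffun 'I_N -> bool}) (m : 'I_N).
Implicit Types (A X : 'M[F]_N) (c : 'cV[F]_N) (d : 'rV[F]_N).

Definition in_col c := supp (fun s _ => ~~ mu s && (s < m)%N) c.
Definition in_row d := supp (fun _ t => mu t && (m < t)%N) d.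

(* If [z], [z'] in [P_mu] are both [m]-covered by [y], then their matrices differ by
   [X = (c + e_m) d] with [c] the [m]-th column of [Y] and [d = row m X]; dually for
   two subspaces [m]-covering a third one. *)
Definition theta_row A : C :=
  \sum_(c | in_col c) \sum_(X | supported_in_B mu X && (X == (c + delta_mx m 0) *m row m X))
    chi (\tr (A *m X^T)).
Definition theta_col A : C :=
  \sum_(d | in_row d) \sum_(X | supported_in_B mu X && (X == col m X *m (delta_mx 0 m - d)))
    chi (\tr (A *m X^T)).

Lemma in_colP c : reflect (forall s, c s 0 != 0 -> ~~ mu s /\ (s < m)%N) (in_col c).
Proof.
apply: (iffP (suppP _ _)) => h; last by move=> i j; rewrite ord1 => /h[-> ->].
by move=> s /h/andP.
Qed.

Lemma in_rowP d : reflect (forall t, d 0 t != 0 -> mu t /\ (m < t)%N) (in_row d).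
Proof.
apply: (iffP (suppP _ _)) => h; last by move=> i j; rewrite ord1 => /h[-> ->].
by move=> s /h/andP.
Qed.

Lemma in_col_m c : in_col c -> c m 0 = 0.
Proof. by move=> h; rewrite (supp0E h) // ltnn andbF. Qed.

Lemma in_row_m d : in_row d -> d 0 m = 0.
Proof. by move=> h; rewrite (supp0E h) // ltnn andbF. Qed.

Lemma supported_mx A : (forall s t, A s t != 0 -> [/\ ~~ mu s, mu t & (s < t)%N]) ->
  supported_in_B mu A.
Proof.
by move=> h; apply/'forall_forallP=> s t; apply/implyP=> /h[mus mut lt]; rewrite !inE mus mut.
Qed.

(** The [c] for which the inner character sum of [theta_row] does not cancel: the linear form
    [(c + e_m)^T A] vanishes to the right of [m]. *)
Definition row_solutions A := [set c | in_col c &&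
   ((c + delta_mx m 0)^T *m (A *m highmx F N m.+1) == 0)].
Definition col_solutions A := [set d | in_row d &&
   (lowmx F N m *m A *m (delta_mx 0 m - d)^T == 0)].

(** As [c m = 0], the admissible [X] are exactly the products [(c + e_m) d] with [d] arbitrary in
    [in_row]. The exponent is then linear in [d], and the sum over [d] is all or nothing. *)
Lemma theta_rowE A : ~~ mu m -> supported_in_B mu A ->
  theta_row A = (#|[pred d | in_row d]| * #|row_solutions A|)%:R.
Proof.
move=> mum sA; rewrite /theta_row.
have -> : #|row_solutions A| = (\sum_(c | in_col c)
  (((c + delta_mx m 0)^T *m (A *m highmx F N m.+1) == 0)%R : nat))%N.
  rewrite -sum1_card big_mkcond [RHS]big_mkcond; apply: eq_bigr => c _; rewrite inE.
  by case: (in_col c) => //=; case: eqP.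
rewrite natrM natr_sum mulr_sumr; apply: eq_bigr => c cC.
have cm := in_col_m cC; have cP := in_colP _ cC.
have rowK d : row m ((c + delta_mx m 0) *m d) = d.
  by apply/rowP=> j; rewrite !mxE big_ord1 !mxE cm !eqxx add0r mul1r.
rewrite (reindex_onto (fun d => (c + delta_mx m 0) *m d) (row m)) /=; last first.
  by move=> X /andP[_ /eqP <-].
rewrite (eq_bigl (in_row)); last first.
  move=> d; rewrite rowK !eqxx !andbT; apply/idP/in_rowP => [sX t dt|dP].
    have := @supportedP _ _ _ _ sX m t; rewrite !mxE big_ord1 !mxE cm !eqxx add0r mul1r.
    by case/(_ dt).
  apply: supported_mx => s t; rewrite !mxE big_ord1 !mxE mulf_eq0 negb_or =>
    /andP[cs /dP[mut lt]].
  have [sm|sm] := eqVneq s m; first by rewrite sm.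
  move: cs; rewrite (negPf sm) /= addr0 => /cP[-> lts]; split=> //; exact: ltn_trans lts lt.
rewrite (eq_bigr (fun d => chi (\tr ((c + delta_mx m 0)^T *m A *m d^T)))); last first.
  by move=> d _; rewrite trmx_mul mulmxA mxtrace_mulC mulmxA.
rewrite (char_sum chi0 chiD chi_nt).
have -> : [forall i : 'I_1, forall j,
  mu j && (m < j)%N ==> (((c + delta_mx m 0)^T *m A) i j == 0)]
   = ((c + delta_mx m 0)^T *m (A *m highmx F N m.+1) == 0).
  rewrite mulmxA; apply/'forall_forallP/eqP => [h|h i j].
    apply/rowP=> j; rewrite mul_highmx mxE [RHS]mxE; case: ifP => // lt.
    have /implyP := h 0 j; case: (boolP (mu j)) => muj; first by move/(_ lt)/eqP.
    move=> _; rewrite mxE big1 // => k _; rewrite (@supported0 _ _ _ _ sA) ?mulr0 //.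
    by rewrite (negPf muj) andbF.
  have e0 : ((c + delta_mx m 0)^T *m A *m highmx F N m.+1) i j = 0 by rewrite h mxE.
  by move: e0; rewrite mul_highmx mxE; case: ifP => lt; [move->;
    rewrite eqxx implybT|rewrite andbF].
by case: eqP => _; rewrite ?mulr1 ?mulr0.
Qed.

Lemma theta_colE A : mu m -> supported_in_B mu A ->
  theta_col A = (#|[pred c | in_col c]| * #|col_solutions A|)%:R.
Proof.
move=> mum sA; rewrite /theta_col.
have -> : #|col_solutions A| = (\sum_(d | in_row d)
  ((lowmx F N m *m A *m (delta_mx 0 m - d)^T == 0)%R : nat))%N.
  rewrite -sum1_card big_mkcond [RHS]big_mkcond; apply: eq_bigr => c _; rewrite inE.
  by case: (in_row c) => //=; case: eqP.
rewrite natrM natr_sum mulr_sumr; apply: eq_bigr => d dD.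
have dm := in_row_m dD; have dP := in_rowP _ dD.
have colK c : col m (c *m (delta_mx 0 m - d)) = c.
  by apply/colP=> j; rewrite !mxE big_ord1 !mxE dm !eqxx subr0 mulr1.
rewrite (reindex_onto (fun c => c *m (delta_mx 0 m - d)) (col m)) /=; last first.
  by move=> X /andP[_ /eqP <-].
rewrite (eq_bigl (in_col)); last first.
  move=> c; rewrite colK !eqxx !andbT; apply/idP/in_colP => [sX t ct|cP].
    have := @supportedP _ _ _ _ sX t m; rewrite !mxE big_ord1 !mxE dm !eqxx subr0 mulr1.
    by case/(_ ct).
  apply: supported_mx => s t; rewrite !mxE big_ord1 !mxE mulf_eq0 negb_or =>
    /andP[/cP[mus lt] dt].
  have [tm|tm] := eqVneq t m; first by rewrite tm.
  move: dt; rewrite (negPf tm) /= sub0r oppr_eq0 => /dP[-> ltt]; split=> //;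
    exact: ltn_trans lt ltt.
rewrite (eq_bigr (fun c => chi (\tr (A *m (delta_mx 0 m - d)^T *m c^T)))); last first.
  by move=> c _; rewrite trmx_mul mulmxA.
rewrite (char_sum chi0 chiD chi_nt).
have -> : [forall i, forall j : 'I_1,
  ~~ mu i && (i < m)%N ==> ((A *m (delta_mx 0 m - d)^T) i j == 0)]
   = (lowmx F N m *m A *m (delta_mx 0 m - d)^T == 0).
  rewrite -mulmxA; apply/'forall_forallP/eqP => [h|h i j].
    apply/colP=> j; rewrite lowmx_mul mxE [RHS]mxE; case: ifP => // lt.
    have /implyP := h j 0; case: (boolP (mu j)) => muj; last by move/(_ lt)/eqP.
    move=> _; rewrite mxE big1 // => k _; rewrite (@supported0 _ _ _ _ sA) ?mul0r //.
    by rewrite muj.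
  have e0 : (lowmx F N m *m (A *m (delta_mx 0 m - d)^T)) i j = 0 by rewrite h mxE.
  by move: e0; rewrite lowmx_mul mxE; case: ifP => lt; [move->;
    rewrite eqxx implybT|rewrite andbF].
by case: eqP => _; rewrite ?mulr1 ?mulr0.
Qed.

Lemma row_solutionsP A : ~~ mu m -> supported_in_B mu A ->
  (exists c, c \in row_solutions A) <-> ~~ row_jump A m m.+1.
Proof.
move=> mum sA; rewrite row_jump_sub negbK; set B := _ *m A *m _.
have eqB c : in_col c -> c^T *m (A *m highmx F N m.+1) = c^T *m B.
  move=> cC; rewrite /B -!mulmxA lowmx_mul; apply/rowP=> j; rewrite !mxE; apply: eq_bigr => k _.
  rewrite [c^T _ _]mxE; have [->|/(in_colP _ cC)[_ lt]] := eqVneq (c k 0) 0;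
    first by rewrite !mul0r.
  by rewrite [in RHS]mxE lt.
split=> [[c]|/submxP[D eD]].
  rewrite inE => /andP[cC]; rewrite linearD /= mulmxDl trmx_delta -rowE addrC addr_eq0 => /eqP ->.
  by rewrite eqB // eqmx_opp submxMl.
(* Truncating [- D] to the rows of [S_mu] before [m] loses nothing: rows in [T_mu] vanish by the
   support of [A], and rows from [m] on are cut off by [lowmx]. *)
pose c : 'cV_N := \col_s if ~~ mu s && (s < m)%N then - D 0 s else 0.
have cC : in_col c.
  by apply/in_colP=> s; rewrite mxE; case: ifP => [/andP[]//|_]; rewrite eqxx.
exists c; rewrite inE cC /= linearD /= mulmxDl trmx_delta -rowE eD eqB //.
rewrite addr_eq0; apply/eqP/rowP=> j; rewrite !mxE -sumrN; apply: eq_bigr => s _.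
rewrite 2!mxE; case: ifP => [_|]; first by rewrite mulNr.
have -> : B s j = if (s < m)%N then (A *m highmx F N m.+1) s j else 0.
  by rewrite /B -mulmxA lowmx_mul mxE.
case: (s < m)%N; last by rewrite !mulr0 oppr0.
rewrite andbT mul_highmx => /negbFE mus; rewrite mxE (@supported0 _ _ _ _ sA) ?mus //.
by rewrite if_same !mulr0 oppr0.
Qed.

Lemma col_solutionsP A : mu m -> supported_in_B mu A ->
  (exists d, d \in col_solutions A) <-> ~~ col_jump A m m.
Proof.
move=> mum sA; rewrite col_jump_sub negbK; set B := lowmx F N m *m A *m _.
have eqB d : in_row d -> lowmx F N m *m A *m d^T = B *m d^T.
  move=> dD; rewrite /B mul_highmx; apply/colP=> j; rewrite [LHS]mxE [RHS]mxE;
    apply: eq_bigr => k _.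
  rewrite [d^T _ _]mxE; have [->|/(in_rowP _ dD)[_ lt]] := eqVneq (d 0 k) 0;
    first by rewrite !mulr0.
  by rewrite [in RHS]mxE lt.
have eqcol : lowmx F N m *m A *m (delta_mx 0 m)^T = col m (lowmx F N m *m A).
  by rewrite trmx_delta -colE.
split=> [[d]|/submxP[D eD]].
  rewrite inE => /andP[dD]; rewrite linearB /= mulmxBr eqcol subr_eq0 => /eqP ->.
  by rewrite eqB // trmx_mul submxMl.
move/(congr1 trmx): eD; rewrite trmxK trmx_mul trmxK => eD.
pose d : 'rV_N := \row_t if mu t && (m < t)%N then D 0 t else 0.
have dD : in_row d.
  by apply/in_rowP=> s; rewrite mxE; case: ifP => [/andP[]//|_]; rewrite eqxx.
exists d; rewrite inE dD /= linearB /= mulmxBr eqcol subr_eq0 eD eqB //.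
apply/eqP/colP=> j; rewrite [LHS]mxE [RHS]mxE; apply: eq_bigr => t _;
  rewrite ![_^T _ _]mxE [d _ _]mxE.
case: ifP => //; rewrite /B mul_highmx 2!mxE; case: (m < t)%N; last by rewrite !mul0r.
rewrite andbT => mut; rewrite big1 ?mul0r // => k _.
by rewrite (@supported0 _ _ _ _ sA) ?mulr0 // mut andbF.
Qed.

(** The solutions form a translate of the homogeneous ones. Filling the positions outside the
    support of [c] with arbitrary entries [e] turns the latter into the whole left kernel of the
    corner [B], whose cardinality is given by the rank. *)
Lemma card_row_solutions A : ~~ mu m -> supported_in_B mu A ->
  ~~ row_jump A m m.+1 ->
  (#|row_solutions A| * #|[pred e : 'cV[F]_N | supp (fun s _ => mu s || (m <= s)%N) e]|
   = #|F| ^ (N - rho A m m.+1))%N.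
Proof.
move=> mum sA /(row_solutionsP mum sA)[c0 c0s].
pose B := lowmx F N m *m A *m highmx F N m.+1.
have BE c : in_col c -> c^T *m (A *m highmx F N m.+1) = c^T *m B.
  move=> cC; rewrite /B -!mulmxA lowmx_mul; apply/rowP=> j; rewrite !mxE; apply: eq_bigr => k _.
  rewrite [c^T _ _]mxE; have [->|/(in_colP _ cC)[_ lt]] := eqVneq (c k 0) 0;
    first by rewrite !mul0r.
  by rewrite [in RHS]mxE lt.
have B0 e : supp (fun s _ => mu s || (m <= s)%N) e -> e^T *m B = 0 :> 'rV_N.
  move=> sE; apply/rowP=> j; rewrite !mxE big1 // => k _; rewrite /B mul_highmx lowmx_mul 3!mxE.
  have [lt|le] := ltnP k m; last by rewrite if_same mulr0.
  have [muk|muk] := boolP (mu k); last by rewrite (supp0E sE) ?mul0r // negb_or muk -ltnNge.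
  by rewrite (@supported0 _ _ _ _ sA) ?muk // if_same mulr0.
have [c0C e0] : in_col c0 /\ c0^T *m B + (delta_mx m 0)^T *m (A *m highmx F N m.+1) = 0.
  by move: c0s; rewrite inE => /andP[c0C /eqP]; rewrite linearD /= mulmxDl (BE c0) // => eq0;
    split.
have -> : #|row_solutions A| = #|[pred c : 'cV[F]_N | in_col c && (c^T *m B == 0)]|.
  rewrite -(card_imset _ (@addIr _ (- c0))); apply: eq_card => c; rewrite [RHS]inE;
    apply/imsetP/andP.
    case=> d; rewrite inE => /andP[dC]; rewrite linearD /= mulmxDl (BE d) // => /eqP ed ->.
    split; first exact: suppB.
    rewrite linearB /= mulmxBl subr_eq0; apply/eqP.
    by apply: (addIr ((delta_mx m 0)^T *m (A *m highmx F N m.+1))); rewrite ed e0.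
  case=> cC /eqP ec; exists (c + c0); last by rewrite addrK.
  rewrite inE (_ : in_col _) /=; last exact: suppD.
  by rewrite !linearD /= !mulmxDl (BE c) // (BE c0) // ec add0r e0.
have <- : #|rowg (kermx B)| = (#|F| ^ (N - rho A m m.+1))%N.
  by rewrite card_rowg mxrank_ker rho_mul.
rewrite -cardX -(card_in_imset (f := fun p => (p.1 + p.2)^T)); last first.
  move=> [c e] [c' e'] /andP[/andP[/= cC _] eE] /andP[/andP[/= cC' _] eE'] /trmx_inj eq.
  have ec : c = c'.
    apply/colP=> i; move/colP/(_ i): eq; rewrite !mxE.
    have [si|si] := boolP (~~ mu i && (i < m)%N); last by rewrite (supp0E cC) // (supp0E cC').
    by rewrite (supp0E eE) ?(supp0E eE') ?addr0 // negb_or -ltnNge.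
  by move: eq; rewrite ec => /addrI ->.
apply: eq_card => v; apply/imsetP/idP => [[[c e] /andP[/andP[/= cC /eqP ec] eE]] ->|].
  by rewrite mem_rowg sub_kermx linearD /= mulmxDl ec B0 ?addr0.
rewrite mem_rowg sub_kermx => /eqP ev.
pose c : 'cV_N := \col_s if ~~ mu s && (s < m)%N then v 0 s else 0.
have cC : in_col c.
  by apply/in_colP=> s; rewrite mxE; case: ifP => [/andP[]//|_]; rewrite eqxx.
have eE : supp (fun s _ => mu s || (m <= s)%N) (v^T - c).
  apply/suppP=> s j; rewrite ord1 !mxE; case: ifP => [_|]; first by rewrite subrr eqxx.
  by move=> + _; rewrite [(m <= s)%N]leqNgt; case: (mu s); case: (s < m)%N.
exists (c, v^T - c); last by rewrite /= addrC subrK trmxK.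
apply/andP; split=> //; rewrite inE cC /=.
by rewrite -[c](subKr v^T) linearB /= mulmxBl (B0 _ eE) trmxK ev subr0.
Qed.

Lemma theta_row_eq0 A : ~~ mu m -> supported_in_B mu A ->
  (theta_row A == 0) = (m \in matrix_type mu A).
Proof.
move=> mum sA; rewrite theta_rowE // pnatr_eq0 muln_eq0 mem_type_row //.
have -> : #|[pred d | in_row d]| == 0%N = false.
  by apply/negbTE; rewrite -lt0n; apply/card_gt0P; exists 0; apply/in_rowP=> t; rewrite mxE eqxx.
rewrite /= cards_eq0; apply/eqP/idP => [s0|h].
  by apply/negPn/negP=> /(row_solutionsP mum sA)[c]; rewrite s0 inE.
by apply/eqP; apply: contraTT h => /set0Pn h; apply/(row_solutionsP mum sA).
Qed.

Lemma theta_col_eq0 A : mu m -> supported_in_B mu A ->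
  (theta_col A == 0) = (m \in matrix_type mu A).
Proof.
move=> mum sA; rewrite theta_colE // pnatr_eq0 muln_eq0 mem_type_col //.
have -> : #|[pred c | in_col c]| == 0%N = false.
  by apply/negbTE; rewrite -lt0n; apply/card_gt0P; exists 0; apply/in_colP=> t; rewrite mxE eqxx.
rewrite /= cards_eq0; apply/eqP/idP => [s0|h].
  by apply/negPn/negP=> /(col_solutionsP mum sA)[c]; rewrite s0 inE.
by apply/eqP; apply: contraTT h => /set0Pn h; apply/(col_solutionsP mum sA).
Qed.

(** Both values vanish if [m] is in the type. Otherwise [card_row_solutions] reduces the claim to
    equality of two corner ranks, which is [rho_type]. *)
Lemma theta_row_type A A' : ~~ mu m -> supported_in_B mu A -> supported_in_B mu A' ->
  matrix_type mu A = matrix_type mu A' -> theta_row A = theta_row A'.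
Proof.
move=> mum sA sA' eqt; have [mt|mt] := boolP (m \in matrix_type mu A).
  have mt' := mt; rewrite eqt in mt'.
  by move: mt mt'; rewrite -!theta_row_eq0 // => /eqP -> /eqP ->.
have mt' := mt; rewrite eqt in mt'; rewrite !mem_type_row // in mt mt'.
rewrite !theta_rowE //; congr (_ * _)%:R.
have := card_row_solutions mum sA mt; have := card_row_solutions mum sA' mt'.
have := rho_type sA mum; have := rho_type sA' mum; rewrite eqt => <- /eqP;
  rewrite eqn_add2r => /eqP ->.
move=> <- /eqP; rewrite eqn_pmul2r; first by move/eqP.
by apply/card_gt0P; exists 0; apply/suppP=> i j; rewrite mxE eqxx.
Qed.

End Theta.

(** * Locations and matrix forms *)

Section Forms.
Variables (F : finFieldType) (N : nat) (H : vectType F).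
Variable x : 'I_N.+1 -> {vspace H}.
Hypothesis hx : full_flag x.
Variable v : N.-tuple H.
Hypothesis hv : adapted_basis x v.
Implicit Types (y z : {vspace H}) (mu nu : {ffun 'I_N -> bool}) (Y Z : 'M[F]_N).

Let free_v : free v. Proof. by case: hv => /basis_free. Qed.

Lemma coord_v i j : coord v i (tnth v j) = (i == j)%:R.
Proof. by rewrite (tnth_nth 0) coord_free // eq_sym. Qed.

Lemma coord_sum w : w = \sum_i coord v i w *: tnth v i.
Proof.
rewrite [LHS](coord_basis (X := v) (U := fullv)) ?memvf //; last by case: hv.
by apply: eq_bigr => i _; rewrite -tnth_nth.
Qed.

Lemma coord_inj w w' : (forall i, coord v i w = coord v i w') -> w = w'.
Proof.
by move=> h; rewrite (coord_sum w) (coord_sum w'); apply: eq_bigr => i _; rewrite h.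
Qed.

Lemma mem_flag (i : 'I_N.+1) w :
  reflect (forall j : 'I_N, (i <= j)%N -> coord v j w = 0) (w \in x i).
Proof.
case: hv => _ ->; apply: (iffP idP) => [wx j leij|h].
  have : w \in lker (linfun (coord v j : H -> F^o)).
    move: wx; apply: subvP; apply/span_subvP=> u /(nthP 0)[k lt <-].
    have ltk : (k < i)%N by have := size_take_min i v; rewrite /= in lt *; move: lt;
      move=> + eqs; rewrite eqs; lia.
    have ltN : (k < N)%N by have := ltn_ord i; lia.
    rewrite nth_take // memv_ker lfunE /= -[k]/(val (Ordinal ltN)) -tnth_nth coord_v.
    by rewrite -val_eqE /= gtn_eqF // (leq_trans ltk).
  by rewrite memv_ker lfunE => /eqP.
rewrite (coord_sum w); apply: memv_suml => j _.
have [le|lt] := leqP i j; first by rewrite h // scale0r mem0v.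
apply/memvZ/memv_span; rewrite (tnth_nth 0) -(nth_take 0 lt) mem_nth //.
by rewrite size_take_min size_tuple leq_min lt ltn_ord.
Qed.

Section Basis.
Variables (mu : {ffun 'I_N -> bool}) (Y : 'M[F]_N).

Definition form_vec t := \sum_(s in Sset mu) Y s t *: tnth v s + tnth v t.
Definition form_space := <<[seq form_vec t | t <- enum (Tset mu)]>>%VS.

Lemma coord_form i t : mu t -> coord v i (form_vec t) = if mu i then (i == t)%:R else Y i t.
Proof.
move=> mut; rewrite linearD linear_sum /= coord_v.
case: ifP => mui.
  rewrite big1 ?add0r // => s; rewrite inE => mus; rewrite linearZ /= coord_v.
  by case: eqP mus => [<-|_]; rewrite ?mui ?mulr0.
rewrite (bigD1 i) /= ?inE ?mui // linearZ /= coord_v eqxx mulr1 big1 => [|s /andP[_ si]].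
  by case: eqP mut => [<-|_]; rewrite ?mui ?addr0.
by rewrite linearZ /= coord_v eq_sym (negPf si) mulr0.
Qed.

Lemma form_free (r : seq 'I_N) : uniq r -> all mu r -> free [seq form_vec t | t <- r].
Proof.
elim: r => [|t r IH] /=; first by rewrite nil_free.
case/andP=> tr ur /andP[mut mur]; rewrite free_cons IH // andbT; apply/negP=> tin.
have : form_vec t \in lker (linfun (coord v t : H -> F^o)).
  move: tin; apply: subvP; apply/span_subvP=> _ /mapP[k kr ->].
  rewrite memv_ker lfunE /= coord_form ?mut; last exact: (allP mur).
  by rewrite (_ : t == k = false) ?eqxx //; apply/negP=> /eqP tk; rewrite tk kr in tr.
by rewrite memv_ker lfunE /= coord_form // mut eqxx oner_eq0.
Qed.

(** The space is a graph: coordinates at [S_mu] are the linear functions, given by [Y], of those at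
    [T_mu]. Inclusions thereby become matrix equations. *)
Lemma mem_form w :
  reflect (forall s, ~~ mu s -> coord v s w = \sum_(t | mu t) Y s t * coord v t w)
    (w \in form_space).
Proof.
apply: (iffP idP) => [ws s mus|h].
  pose f : 'Hom(H, F^o) := linfun (coord v s : H -> F^o)
     - \sum_(t | mu t) Y s t *: linfun (coord v t : H -> F^o).
  have fE u : f u = coord v s u - \sum_(t | mu t) Y s t * coord v t u.
    rewrite add_lfunE opp_lfunE sum_lfunE lfunE /=; congr (_ - _).
    by apply: eq_bigr => t _; rewrite scale_lfunE lfunE.
  have : w \in lker f.
    move: ws; apply: subvP; apply/span_subvP=> u /mapP[t + ->]; rewrite mem_enum inE => mut.
    rewrite memv_ker fE coord_form // (negPf mus) (bigD1 t) //= coord_form // mut eqxx mulr1.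
    rewrite big1 ?addr0 ?subrr // => k /andP[muk kt].
    by rewrite coord_form // muk (negPf kt) mulr0.
  by rewrite memv_ker fE subr_eq0 => /eqP.
have -> : w = \sum_(t | mu t) coord v t w *: form_vec t.
  apply: coord_inj => i; rewrite linear_sum /=.
  have [mui|mui] := boolP (mu i).
    rewrite (bigD1 i) //= linearZ /= coord_form // mui eqxx mulr1 big1 ?addr0 // =>
      k /andP[muk ki].
    by rewrite linearZ /= coord_form // mui eq_sym (negPf ki) mulr0.
  rewrite h //; apply: eq_bigr => t mut; rewrite linearZ /= coord_form // (negPf mui).
  by rewrite mulrC.
apply: memv_suml => t mut; apply/memvZ/memv_span/map_f.
by rewrite mem_enum inE.
Qed.

Hypothesis sY : supported_in_B mu Y.

Lemma form_flag (m : 'I_N.+1) :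
  (form_space :&: x m = <<[seq form_vec t | t : 'I_N <- enum (Tset mu) & (t < m)%N]>>)%VS.
Proof.
apply/eqP; rewrite eqEsubv; apply/andP; split; last first.
  apply/span_subvP=> u /mapP[t + ->]; rewrite mem_filter mem_enum inE => /andP[lt mut].
  rewrite memv_cap memv_span ?map_f ?mem_enum ?inE //=; apply/mem_flag=> j lej.
  rewrite coord_form //; case: ifP => muj.
    by case: eqP => // jt; move: lej; rewrite jt leqNgt lt.
  by rewrite (@supported0 _ _ _ _ sY) // [(j < t)%N]ltnNge (ltnW (leq_trans lt lej)) !andbF.
apply/subvP=> w; rewrite memv_cap => /andP[/mem_form wf /mem_flag wx].
have -> : w = \sum_(t | mu t) coord v t w *: form_vec t.
  apply: coord_inj => i; rewrite linear_sum /=.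
  have [mui|mui] := boolP (mu i).
    rewrite (bigD1 i) //= linearZ /= coord_form // mui eqxx mulr1 big1 ?addr0 // =>
      k /andP[muk ki].
    by rewrite linearZ /= coord_form // mui eq_sym (negPf ki) mulr0.
  rewrite wf //; apply: eq_bigr => t mut; rewrite linearZ /= coord_form // (negPf mui).
  by rewrite mulrC.
apply: memv_suml => t mut; have [le|lt] := leqP m t; first by rewrite wx // scale0r mem0v.
by apply/memvZ/memv_span/map_f; rewrite mem_filter lt mem_enum inE.
Qed.

Lemma form_location : has_location x form_space mu.
Proof.
apply/forallP=> m; rewrite form_flag; apply/eqP.
have /eqP -> : free [seq form_vec t | t : 'I_N <- enum (Tset mu) & (t < m)%N].
  apply: form_free; first by rewrite filter_uniq // enum_uniq.
  by apply/allP=> t; rewrite mem_filter mem_enum inE => /andP[].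
rewrite size_map -big_mkcondr_idem //= -sum1_size big_filter big_enum_cond /= !big_mkcond /=
  [RHS]big_mkcond /=.
by apply: eq_bigr => i _; rewrite inE; case: (mu i); case: (i < m)%N.
Qed.

Lemma form_matrix : is_matrix_form v mu Y form_space.
Proof.
rewrite /is_matrix_form sY /= basisEfree subvv; apply/and3P; split=> //.
  by apply: form_free; [apply: enum_uniq|apply/allP=> t; rewrite mem_enum inE].
exact: dim_span.
Qed.

End Basis.

Lemma location_uniq y mu nu : has_location x y mu -> has_location x y nu -> mu = nu.
Proof.
move=> /forallP h /forallP h'; apply/ffunP=> i.
have ltS : (i.+1 < N.+1)%N by rewrite ltnS.
have lt : (i < N.+1)%N by apply: ltnW.
have SE (f : {ffun 'I_N -> bool}) : (\sum_(j < N | j < i.+1) f j = f i + \sum_(j < N | j < i) f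
  j)%N.
  rewrite (bigD1 i) //=; congr (_ + _)%N; apply: eq_bigl => j; rewrite -val_eqE /=; lia.
move: (h (Ordinal ltS)) (h' (Ordinal ltS)) => /eqP -> /=; rewrite !SE => /eqP.
move: (h (Ordinal lt)) (h' (Ordinal lt)) => /eqP -> /= /eqP ->.
by move/eqP; rewrite eqn_add2r; case: (mu i); case: (nu i).
Qed.

Lemma form_inj mu Y Y' : supported_in_B mu Y -> supported_in_B mu Y' ->
  form_space mu Y = form_space mu Y' -> Y = Y'.
Proof.
move=> sY sY' eqf; apply/matrixP=> s t.
have [mut|mut] := boolP (mu t); last first.
  by rewrite (@supported0 _ _ _ _ sY) ?(@supported0 _ _ _ _ sY') // (negPf mut) andbF.
have [mus|mus] := boolP (mu s).
  by rewrite (@supported0 _ _ _ _ sY) ?(@supported0 _ _ _ _ sY') // mus.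
have : form_vec mu Y t \in form_space mu Y by apply/memv_span/map_f; rewrite mem_enum inE.
rewrite eqf => /mem_form/(_ s mus); rewrite coord_form // (negPf mus) => ->.
rewrite (bigD1 t) //= coord_form // mut eqxx mulr1 big1 ?addr0 // => k /andP[muk kt].
by rewrite coord_form // muk (negPf kt) mulr0.
Qed.

(** The positions of the last nonzero coordinates of vectors of [y]. This is the location of [y] by
    a direct formula, free of the search in [location]. *)
Definition lead_loc y : {ffun 'I_N -> bool} :=
  [ffun t : 'I_N => ~~ (y :&: x (inord t.+1) <= x (inord t))%VS].

Lemma lead_locP y t :
  reflect (exists w, [/\ w \in y, coord v t w != 0 & forall j : 'I_N, (t < j)%N ->
    coord v j w = 0])
    (lead_loc y t).
Proof.
have t1 : (inord t.+1 : 'I_N.+1) = t.+1 :> nat by rewrite inordK // ltnS.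
have t0 : (inord t : 'I_N.+1) = t :> nat by rewrite inordK // ltnS ltnW.
rewrite /lead_loc ffunE; apply: (iffP idP) => [/subvPn[w]|[w [wy nz w0]]]; last apply/subvPn.
  rewrite memv_cap => /andP[wy /mem_flag wx] nw; exists w; split=> // [|j lt];
    last by rewrite wx // t1.
  apply: contra nw => /eqP w0; apply/mem_flag=> j; rewrite t0 leq_eqVlt.
  by case/orP=> [/eqP/val_inj <-//|lt]; rewrite wx // t1.
exists w; first by rewrite memv_cap wy; apply/mem_flag=> j; rewrite t1; apply: w0.
by apply: contra nz => /mem_flag/(_ t); rewrite t0 => ->.
Qed.

Lemma has_lead y w : w \in y -> w != 0 -> exists2 t, lead_loc y t & coord v t w != 0.
Proof.
move=> wy w0; have [i nzi] : exists i, coord v i w != 0.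
  apply/existsP; apply: contraR w0; rewrite negb_exists => /forallP h.
  by rewrite (coord_sum w) big1 // => i _; have := h i; rewrite negbK => /eqP ->; rewrite scale0r.
have [t nzt tmax] := @arg_maxnP _ i (fun i => coord v i w != 0) val nzi.
exists t => //; apply/lead_locP; exists w; split=> // j lt; apply/eqP.
by apply: contraTT lt => /tmax /=; rewrite -leqNgt.
Qed.

(** Gaussian elimination from position [k - 1] downwards: subtracting a multiple of a vector of [y]
    led by a position alters no later coordinate. *)
Lemma reduce y k w : w \in y -> exists2 w', w' \in y &
  (forall i : 'I_N, (k <= i)%N -> coord v i w' = coord v i w) /\
  (forall t : 'I_N, lead_loc y t -> (t < k)%N -> coord v t w' = 0).
Proof.
elim: k w => [|k IH] w wy; first by exists w.
have [lt|le] := ltnP k N; last first.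
  have [w' wy' [h1 h2]] := IH w wy; exists w' => //; split=> [i lti|t lt _];
    first by apply: h1; lia.
  by apply: h2 => //; have := ltn_ord t; lia.
pose i0 := Ordinal lt; have [|nl] := boolP (lead_loc y i0).
  case/lead_locP=> u [uy nz u0].
  have w1y : w - (coord v i0 w / coord v i0 u) *: u \in y by rewrite rpredB // rpredZ.
  have [w' wy' [h1 h2]] := IH _ w1y; exists w' => //; split=> [i lti|t lt' ltk].
    by rewrite h1 ?(ltnW lti) // linearB linearZ /= (u0 i) // mulr0 subr0.
  have [ltt|] := ltnP t k; first exact: h2.
  move=> le; have -> : t = i0 by apply/val_inj/eqP; rewrite eqn_leq le -ltnS ltk.
  by rewrite h1 // linearB linearZ /= divfK // subrr.
have [w' wy' [h1 h2]] := IH w wy; exists w' => //; split=> [i lti|t lt' ltk];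
  first by apply: h1; lia.
apply: h2 => //; rewrite ltnS leq_eqVlt in ltk; case/orP: ltk => // /eqP tk.
by rewrite -(_ : t = i0) ?lt' // in nl; apply/val_inj.
Qed.

Lemma form_exists y : exists2 Y, supported_in_B (lead_loc y) Y & y = form_space (lead_loc y) Y.
Proof.
set mu := lead_loc y.
have /fin_all_exists[u uP] : forall t : 'I_N, exists u, mu t ->
   [/\ u \in y, forall i : 'I_N, mu i -> coord v i u = (i == t)%:R &
    forall i : 'I_N, (t < i)%N -> coord v i u = 0].
  move=> t; have [/lead_locP[w [wy nz w0]]|_] := boolP (mu t); last by exists 0.
  have [w' wy' [h1 h2]] := reduce t wy; exists ((coord v t w)^-1 *: w') => _.
  split=> [|i mui|i lt]; first exact: rpredZ;
    last by rewrite linearZ /= h1 ?(ltnW lt) // (w0 i) ?mulr0.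
  rewrite linearZ /=; case: (ltngtP i t) => [lt|lt|/val_inj ->]; last by rewrite h1 // eqxx mulVf.
    by rewrite h2 // mulr0 -val_eqE /= ltn_eqF.
  by rewrite h1 ?(ltnW lt) // (w0 i) // mulr0 -val_eqE /= gtn_eqF.
pose Y : 'M[F]_N := \matrix_(s, t) if ~~ mu s && mu t then coord v s (u t) else 0.
have fu t : mu t -> form_vec mu Y t = u t.
  move=> mut; have [_ h1 _] := uP t mut; apply: coord_inj => i; rewrite coord_form //.
  by case: ifP => mui; [rewrite h1|rewrite mxE mui mut].
exists Y.
  apply/'forall_forallP=> s t; apply/implyP; rewrite mxE; case: ifP => [/andP[mus mut] nz|];
    last by rewrite eqxx.
  rewrite !inE mus mut /=; have [_ h1 h2] := uP t mut; case: (ltngtP s t) => // [lt|/val_inj st].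
    by rewrite h2 ?eqxx in nz.
  by rewrite st mut in mus.
apply/eqP; rewrite eqEsubv; apply/andP; split; last first.
  by apply/span_subvP=> u' /mapP[t + ->]; rewrite mem_enum inE => mut; rewrite fu //;
    case: (uP t mut).
(* [w'] lies in [y] and vanishes at every leading position, so it is zero by [has_lead]. *)
apply/subvP=> w wy; pose w' := w - \sum_(t | mu t) coord v t w *: u t.
have wy' : w' \in y.
  by rewrite rpredB // rpred_sum // => t mut; rewrite rpredZ //; case: (uP t mut).
have : w' == 0.
  apply/negPn/negP=> /(has_lead wy')[t mut]; rewrite linearB linear_sum /= (bigD1 t) //=.
  rewrite linearZ /=; have [_ -> // _] := uP t mut;
    rewrite eqxx mulr1 big1 ?addr0 ?subrr ?eqxx //.
  by move=> k /andP[muk kt]; rewrite linearZ /=; have [_ -> // _] := uP k muk;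
    rewrite eq_sym (negPf kt) mulr0.
rewrite subr_eq0 => /eqP ->; apply: memv_suml => t mut; rewrite -fu //.
by apply/memvZ/memv_span/map_f; rewrite mem_enum inE.
Qed.

Lemma location_form mu Y : supported_in_B mu Y -> location x (form_space mu Y) = mu.
Proof.
move=> sY; have h := form_location sY; rewrite /location; case: pickP => [nu hn|/(_ mu)].
  exact: location_uniq hn h.
by rewrite h.
Qed.

Lemma matrix_form_form mu Y : supported_in_B mu Y -> matrix_form x v (form_space mu Y) = Y.
Proof.
move=> sY; rewrite /matrix_form location_form //; case: pickP => [Y'|/(_ Y)];
  last by rewrite form_matrix.
by case/andP=> sY' /andP[/eqP eqs _]; apply: (form_inj sY' sY).
Qed.

Lemma location_lead y : location x y = lead_loc y.
Proof. by have [Y sY eqy] := form_exists y; rewrite {1}eqy location_form. Qed.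

Lemma matrix_form_supp y : supported_in_B (location x y) (matrix_form x v y).
Proof.
rewrite location_lead; have [Y sY eqy] := form_exists y.
by rewrite [X in matrix_form _ _ X]eqy matrix_form_form.
Qed.

Lemma form_matrix_form y : form_space (location x y) (matrix_form x v y) = y.
Proof.
rewrite location_lead; have [Y sY eqy] := form_exists y.
by rewrite [X in matrix_form _ _ X]eqy matrix_form_form.
Qed.

Lemma mem_location y w :
  reflect (forall s, ~~ location x y s -> coord v s w =
             \sum_(t | location x y t) matrix_form x v y s t * coord v t w)
    (w \in y).
Proof. by have := mem_form (location x y) (matrix_form x v y) w; rewrite form_matrix_form. Qed.

Lemma dim_location y : \dim y = (\sum_i location x y i)%N.
Proof.
have /forallP/(_ ord_max)/eqP := form_location (matrix_form_supp y).
rewrite form_matrix_form; case: hx => _ -> _ _; rewrite capvf => ->.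
by apply: eq_bigl => i; rewrite /= ltn_ord.
Qed.

Lemma location_sub y z i : (z <= y)%VS -> location x z i -> location x y i.
Proof.
move=> /subvP szy; rewrite !location_lead => /lead_locP[w [wz nz w0]].
by apply/lead_locP; exists w; split=> //; apply: szy.
Qed.

Definition loc_up mu (m : 'I_N) : {ffun 'I_N -> bool} := [ffun i => mu i || (i == m)].

(** Tests the basis vectors of [z] against the equations of [y]. The columns of [y] are those of [z]
    and [m], so only columns [t] and [m] contribute for the vector at [t]. The condition on
    dimensions follows from the one on locations. *)
Lemma coversE m y z : covers x m y z =
  [&& ~~ location x z m, location x y == loc_up (location x z) m &
    [forall s, forall t, ~~ location x y s ==> location x z t ==>
      (matrix_form x v z s t ==
       matrix_form x v y s t + matrix_form x v y s m * matrix_form x v z m t)]].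
Proof.
set mu := location x y; set nu := location x z.
set Y := matrix_form x v y; set Z := matrix_form x v z.
have eqloc : [forall i, mu i == (nu i + (i == m))%N :> nat] = ~~ nu m && (mu == loc_up nu m).
  apply/'forall_eqP/andP => [h|[num /eqP-> i]].
    split; first by have := h m; rewrite eqxx; case: (nu m); case: (mu m).
    by apply/eqP/ffunP=> i; have := h i; rewrite ffunE; case: (i == m); case: (nu i);
      case: (mu i).
  by rewrite ffunE; case: eqP => [->|_]; [rewrite (negPf num)|case: (nu i)].
rewrite /covers -/mu -/nu eqloc [RHS]andbA; set L := _ && (mu == _).
case: (boolP L) => [/andP[num /eqP mun]|_]; last by rewrite !andbF.
rewrite andTb andbT.
have -> : \dim y == (\dim z).+1.
  rewrite !dim_location -/mu -/nu mun (bigD1 m) //= [in X in _ == X](bigD1 m) //= ffunE eqxx orbT.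
  rewrite (negPf num) add1n add0n eqSS; apply/eqP/eq_bigr => i im.
  by rewrite ffunE (negPf im) orbF.
rewrite andbT.
have mum : mu m by rewrite mun ffunE eqxx orbT.
have numu t : nu t -> mu t by rewrite mun ffunE => ->.
have sumE s t : nu t -> \sum_(k | mu k) Y s k * coord v k (form_vec nu Z t) = Y s t + Y s m * Z
  m t.
  move=> nut; rewrite (bigD1 m) //= (bigD1 t) /=; last first.
    by rewrite numu //; apply: contraNneq num => <-.
  rewrite !coord_form // nut (negPf num) eqxx mulr1 addrCA big1 ?addr0 // => k.
  case/andP=> /andP[muk km] kt; rewrite coord_form //.
  by move: muk; rewrite mun ffunE (negPf km) orbF => ->; rewrite (negPf kt) mulr0.
rewrite -[z in (z <= _)%VS]form_matrix_form -/nu -/Z; apply/idP/'forall_forallP => [szy s t|h].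
  apply/implyP=> mus; apply/implyP=> nut; rewrite -sumE //.
  have /(subvP szy)/mem_location/(_ s mus) <- : form_vec nu Z t \in form_space nu Z.
    by apply/memv_span/map_f; rewrite mem_enum inE.
  by rewrite coord_form // (negPf (contra (@numu s) mus)).
apply/span_subvP=> u /mapP[t + ->]; rewrite mem_enum inE => nut.
apply/mem_location=> s mus; rewrite sumE // coord_form // (negPf (contra (@numu s) mus)).
by have /implyP/(_ mus)/implyP/(_ nut)/eqP := h s t.
Qed.

(** The location of [z] is bounded by that of [y], and their sums are the dimensions, so they differ
    in exactly one place. *)
Lemma covers_exists y z : (z <= y)%VS -> \dim y = (\dim z).+1 -> exists m, covers x m y z.
Proof.
move=> szy dimy; have h i := @location_sub y z i szy.
have [m /andP[ym zm]] : exists m, location x y m && ~~ location x z m.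
  apply/existsP; apply: contra_eqT dimy; rewrite negb_exists => /forallP eqm.
  rewrite !dim_location (eq_bigr (fun i => location x z i : nat)).
    by rewrite neq_ltn leqnn.
  move=> i _; have := eqm i; have := h i; case: (location x y i); case: (location x z i) => //=.
  by move=> /(_ isT).
exists m; rewrite /covers szy dimy eqxx /=; apply/forallP=> i; apply/eqP.
have [->|im] := eqVneq i m; first by rewrite ym (negPf zm).
move: dimy; rewrite !dim_location (bigD1 m) //= [in RHS](bigD1 m) //= ym (negPf zm) add1n add0n
  => -[].
rewrite (bigD1 i) //= [in RHS](bigD1 i) //=.
have : (\sum_(i0 < N | (i0 != m) && (i0 != i)) location x z i0 <= \sum_(i0 < N | (i0 != m) &&
  (i0 != i)) location x y i0)%N.
  by apply: leq_sum => j _; have := h j; case: (location x z j) => // ->.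
have := h i; case: (location x z i); case: (location x y i) => //; first by move=> /(_ isT).
by rewrite add0n add1n => _ le e; rewrite -e ltnn in le.
Qed.

Lemma covers_location m y z i : covers x m y z ->
  location x y i = (location x z i + (i == m) :> nat)%N :> nat.
Proof. by case/and3P=> _ _ /forallP/(_ i)/eqP. Qed.

(* With [z] and [z'] distinct hyperplanes of [y], [y = z + z'] and their common
   hyperplane is [z :&: z'], so either of [y] and [w] determines the other. *)
Lemma covers_exchange m n z z' : m != n ->
  (\sum_y (covers x m y z' && covers x n y z) = \sum_w (covers x n z' w && covers x m z w))%N.
Proof.
move=> mn.
have locne w : covers x n z' w -> covers x m z w -> z != z'.
  move=> c1 c2; apply: contra mn => /eqP e; rewrite e in c2; apply/eqP.
  have := covers_location n c1; rewrite (covers_location n c2) eqxx.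
  by case: eqP => // _ /eqP; rewrite eqn_add2l.
have locne' y : covers x m y z' -> covers x n y z -> z != z'.
  move=> c1 c2; apply: contra mn => /eqP e; rewrite e in c2; apply/eqP.
  have := covers_location n c1; rewrite (covers_location n c2) eqxx.
  by case: eqP => // _ /eqP; rewrite eqn_add2l.
have up y : covers x m y z' -> covers x n y z -> y = (z + z')%VS /\
    (covers x n z' (z :&: z') && covers x m z (z :&: z'))%VS.
  move=> c1 c2; have ne := locne' y c1 c2; have /and3P[s1 /eqP d1 _] := c1.
  have /and3P[s2 /eqP d2 _] := c2.
  have szz : \dim z = \dim z' by apply/eqP; rewrite -eqSS -d1 -d2.
  have ss : (z + z' <= y)%VS by rewrite subv_add s2 s1.
  have lt : (\dim z < \dim (z + z'))%N.
    rewrite ltn_neqAle dimvS ?addvSl // andbT; apply: contra ne => /eqP e.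
    have e1 : z = (z + z')%VS by apply/eqP; rewrite eqEdim addvSl e leqnn.
    by rewrite eq_sym eqEdim szz leqnn andbT e1 addvSr.
  have dd : \dim (z + z') = \dim y by apply/eqP; rewrite eqn_leq dimvS //= d2.
  have eqy : y = (z + z')%VS by apply/esym/eqP; rewrite eqEdim ss dd leqnn.
  split=> //; have := dimv_sum_cap z z'; rewrite dd d2 szz => dcap.
  have dz : \dim z = (\dim (z :&: z')).+1 by lia.
  have [a ca] := covers_exists (capvSl z z') dz.
  have [b cb] := covers_exists (capvSr z z') (etrans (esym szz) dz).
  (* The location of [y] is computed along the chains through [z] and through [z']. As [m != n], the
     label of each lower edge equals that of the opposite upper edge. *)
  have key i : ((i == a) + (i == n) = (i == b) + (i == m))%N.
    have := covers_location i c1; rewrite (covers_location i c2).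
      by move/eqP; rewrite (covers_location i ca) (covers_location i cb) -!addnA eqn_add2l =>
        /eqP.
  have an : b = n.
    apply/eqP; rewrite eq_sym; have := key n; rewrite eqxx (negPf (_ : n != m));
      last by rewrite eq_sym.
    by case: (n == b) => //; rewrite addn1.
  have bm : a = m.
    apply/eqP; rewrite eq_sym; have := key m; rewrite eqxx (negPf mn) addn1 addn0.
    by case: (m == a).
  by rewrite -{1}an -bm cb ca.
have down w : covers x n z' w -> covers x m z w -> w = (z :&: z')%VS /\
    (covers x m (z + z') z' && covers x n (z + z') z)%VS.
  move=> c1 c2; have ne := locne w c1 c2; have /and3P[s1 /eqP d1 _] := c1.
  have /and3P[s2 /eqP d2 _] := c2.
  have szz : \dim z = \dim z' by rewrite d1 d2.
  have ss : (w <= z :&: z')%VS by rewrite subv_cap s2 s1.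
  have lt : (\dim (z :&: z') < \dim z)%N.
    rewrite ltn_neqAle dimvS ?capvSl // andbT; apply: contra ne => /eqP e.
    have e1 : (z :&: z')%VS = z by apply/eqP; rewrite eqEdim capvSl e leqnn.
    by rewrite eqEdim szz leqnn andbT -{1}e1 capvSr.
  have dd : \dim (z :&: z') = \dim w.
    by apply/eqP; rewrite eqn_leq [X in _ && X]dimvS // andbT -ltnS -d2.
  have eqw : w = (z :&: z')%VS by apply/eqP; rewrite eqEdim ss dd leqnn.
  split=> //; have := dimv_sum_cap z z'; rewrite dd => dcap.
  have dz : \dim (z + z') = (\dim z).+1 by lia.
  have [a ca] := covers_exists (addvSl z z') dz.
  have [b cb] := covers_exists (addvSr z z') (etrans dz (congr1 succn szz)).
  have key i : ((i == m) + (i == a) = (i == n) + (i == b))%N.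
    have := covers_location i ca; rewrite (covers_location i cb).
    by move/esym/eqP; rewrite (covers_location i c1) (covers_location i c2) -!addnA eqn_add2l =>
      /eqP.
  have an : a = n.
    apply/eqP; rewrite eq_sym; have := key n; rewrite eqxx (negPf (_ : n != m));
      last by rewrite eq_sym.
    by case: (n == a) => //; case: (n == b).
  have bm : b = m.
    apply/eqP; rewrite eq_sym; have := key m; rewrite eqxx (negPf mn).
    by case: (m == a); case: (m == b).
  by rewrite -{1}bm -an cb ca.
have sumE (P : pred {vspace H}) u : (forall y, P y -> y = u) -> (\sum_y P y = P u)%N.
  move=> h; rewrite (bigD1 u) //= big1 ?addn0 // => y yu.
  by case: (boolP (P y)) => // /h e; rewrite e eqxx in yu.
rewrite (sumE (fun y => covers x m y z' && covers x n y z) (z + z')%VS);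
  last by move=> y /andP[c1 /(up y c1)[]].
rewrite (sumE (fun w => covers x n z' w && covers x m z w) (z :&: z')%VS);
  last by move=> y /andP[c1 /(down y c1)[]].
congr nat_of_bool; apply/idP/idP => /andP[c1 c2]; first by case: (up _ c1 c2).
by case: (down _ c1 c2).
Qed.

End Forms.

(** * Counting common covers *)

Lemma card_bij (T U : finType) (A : pred T) (B : pred U) (f : T -> U) (g : U -> T) :
  (forall a, A a -> B (f a) /\ g (f a) = a) -> (forall b, B b -> A (g b) /\ f (g b) = b) ->
  #|A| = #|B|.
Proof.
move=> fP gP; rewrite -(@card_in_imset _ _ f A) => [|a a' /fP[_ e] /fP[_ e'] eqf];
  last by rewrite -e eqf e'.
apply: eq_card => b; apply/imsetP/idP => [[a /fP[Bfa _] ->] //|/gP[Agb <-]].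
by exists (g b).
Qed.

Section Counting.
Variables (F : finFieldType) (N : nat) (H : vectType F).
Variable x : 'I_N.+1 -> {vspace H}.
Hypothesis hx : full_flag x.
Variable v : N.-tuple H.
Hypothesis hv : adapted_basis x v.
Implicit Types (y z w : {vspace H}) (mu nu : {ffun 'I_N -> bool}) (Y Z : 'M[F]_N).

(* Locked, so that unification never unfolds the searches defining them. *)
Definition mform := locked (matrix_form x v).
Definition locn := locked (location x).
Local Notation loc := locn.
Local Notation mf := mform.
Local Notation mk mu Y := (form_space v mu Y).

Lemma mformE : mform = matrix_form x v. Proof. by rewrite /mform -lock. Qed.
Lemma locnE : locn = location x. Proof. by rewrite /locn -lock. Qed.

Lemma mform_supp y : supported_in_B (loc y) (mf y).
Proof. by rewrite locnE mformE; apply: (matrix_form_supp hv). Qed.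

Lemma form_mform y : mk (loc y) (mf y) = y.
Proof. by rewrite locnE mformE; apply: (form_matrix_form hv). Qed.

(** Lets a matrix be given by a formula that is meaningful on [S_mu x T_mu] only. *)
Definition mask mu Y : 'M[F]_N := \matrix_(s, t) if ~~ mu s && mu t then Y s t else 0.

Lemma mask_supp mu Y : (forall s t, ~~ mu s -> mu t -> Y s t != 0 -> (s < t)%N) ->
  supported_in_B mu (mask mu Y).
Proof.
move=> h; apply: supported_mx => s t; rewrite mxE; case: ifP => [/andP[mus mut] nz|];
  last by rewrite eqxx.
by split=> //; apply: h.
Qed.

Lemma maskE mu Y s t : ~~ mu s -> mu t -> mask mu Y s t = Y s t.
Proof. by move=> mus mut; rewrite mxE mus mut. Qed.

Lemma supp_eq mu Y Z : supported_in_B mu Y -> supported_in_B mu Z ->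
  (forall s t, ~~ mu s -> mu t -> Y s t = Z s t) -> Y = Z.
Proof.
move=> sY sZ h; apply/matrixP=> s t; have [mus|mus] := boolP (mu s).
  by rewrite (supported0 sY) ?(supported0 sZ) // mus.
have [mut|mut] := boolP (mu t); first exact: h.
by rewrite (supported0 sY) ?(supported0 sZ) // (negPf mut) andbF.
Qed.

Lemma form_eq y mu Y : supported_in_B mu Y -> loc y = mu ->
  (forall s t, ~~ mu s -> mu t -> mf y s t = Y s t) -> y = mk mu Y.
Proof.
move=> sY ly h; rewrite -(form_mform y) ly; congr (mk _ _).
by apply: supp_eq sY h; rewrite -ly; apply: mform_supp.
Qed.

Lemma covers_relP m y z : reflect
  [/\ ~~ loc z m, loc y = loc_up (loc z) m & forall s t, ~~ loc y s -> loc z t ->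
      mf z s t = mf y s t + mf y s m * mf z m t] (covers x m y z).
Proof.
rewrite locnE mformE (coversE hx hv);
  apply: (iffP and3P) => [[h1 /eqP h2 /'forall_forallP h3]|[h1 h2 h3]].
  by split=> // s t ys zt; have /implyP/(_ ys)/implyP/(_ zt)/eqP := h3 s t.
split=> //; first exact/eqP; apply/'forall_forallP=> s t.
by apply/implyP=> ys; apply/implyP=> zt; rewrite h3.
Qed.

Lemma mf_supp y s t : mf y s t != 0 -> [/\ ~~ loc y s, loc y t & (s < t)%N].
Proof. exact: (supportedP (mform_supp y)). Qed.

Lemma loc_mk mu Y : supported_in_B mu Y -> loc (mk mu Y) = mu.
Proof. by rewrite locnE; apply: (location_form hv). Qed.

Lemma mf_mk mu Y : supported_in_B mu Y -> mf (mk mu Y) = Y.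
Proof. by rewrite mformE; apply: (matrix_form_form hv). Qed.

Section TwoStep.
Variables (m n : 'I_N) (y z : {vspace H}).
Hypothesis mn : m != n.

(* [z <= y] with locations differing by [m] and [n], in matrix coordinates. A [w]
   between them is determined by the entry [k = W m n] of its matrix [W k]. *)
Definition two_step :=
  [&& ~~ loc z m, ~~ loc z n, loc y == loc_up (loc_up (loc z) n) m &
    [forall s, forall t, ~~ loc y s ==> loc z t ==>
      (mf z s t == mf y s t + mf y s m * mf z m t + mf y s n * mf z n t)]].

Let om := loc_up (loc z) n.
(** Row [m] of the intermediate matrix: [k] in the new column [n], and elsewhere the value forced by
    the covering of [z]. The other rows of [W k] are forced by the covering under [y]. *)
Let r k t := if t == n then k else mf z m t - k * mf z n t.
Let W k := mask om (\matrix_(s, t) if s == m then r k t else mf y s t + mf y s m * r k t).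

Lemma two_stepE w : covers x m y w -> covers x n w z -> two_step.
Proof.
move=> /covers_relP[wm ly eqw] /covers_relP[zn lw eqz].
have lz t : loc z t -> loc w t by rewrite lw ffunE => ->.
rewrite /two_step zn ly lw eqxx /=; apply/andP; split; first exact: contra (@lz m) wm.
apply/'forall_forallP=> s t; rewrite -lw -ly; apply/implyP=> ys; apply/implyP=> zt.
have ws : ~~ loc w s by apply: contra ys; rewrite ly ffunE => ->.
rewrite eqz // eqw ?lz // (eqw s n) //; last by rewrite lw ffunE eqxx orbT.
rewrite (eqz m t) //; apply/eqP; ring.
Qed.

Lemma two_step_supp k : two_step -> (k != 0 -> (m < n)%N) -> supported_in_B om (W k).
Proof.
case/and4P=> zm zn /eqP ly _ km.
have rP t : r k t != 0 -> (m < t)%N.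
  rewrite /r; case: (t =P n) => [->|_]; first exact: km.
  have [->|/mf_supp[_ _ lt]] := eqVneq (mf z m t) 0; last by [].
  by rewrite sub0r oppr_eq0 mulf_eq0 negb_or => /andP[/km + /mf_supp[_ _]]; apply: ltn_trans.
apply: mask_supp => s t oms omt; rewrite mxE; case: (s =P m) => [-> /rP//|_].
have [->|/mf_supp[_ _ lt] _] := eqVneq (mf y s t) 0; last by [].
by rewrite add0r mulf_eq0 negb_or => /andP[/mf_supp[_ _ +] /rP]; apply: ltn_trans.
Qed.

(** The only freedom in [w] is the entry [k] at [(m, n)], which support allows to be nonzero only if
    [m < n]. Hence there are [q] intermediate spaces in that case and one otherwise, as soon as
    there is any. *)
Lemma card_two_step :
  #|[pred w | covers x m y w && covers x n w z]| =
  (#|[pred k : F | (k != 0)%R ==> (m < n)%N]| * two_step)%N.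
Proof.
case: (boolP two_step) => [ts|nts]; last first.
  rewrite muln0; apply: eq_card0 => w; apply/negbTE; apply: contra nts => /andP[].
  exact: two_stepE.
have /and4P[zm zn /eqP ly /'forall_forallP eqyz] := ts.
have omm : ~~ om m by rewrite ffunE (negPf zm) /=.
have omn : om n by rewrite ffunE eqxx orbT.
rewrite muln1; apply: (card_bij (f := fun w => mf w m n) (g :=
  fun k => mk om (W k))) => [w /andP[c1 c2]|k /implyP km].
  have /covers_relP[wm _ eqw] := c1; have /covers_relP[_ lw eqz] := c2.
  have km : mf w m n != 0 -> (m < n)%N by case/mf_supp.
  split; first exact/implyP.
  have sW := two_step_supp ts km.
  apply/esym/form_eq => // s t oms omt; rewrite maskE // mxE.
  have mrE t' : om t' -> mf w m t' = r (mf w m n) t'.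
    rewrite /r; case: (t' =P n) => [->//|/eqP tn]; rewrite ffunE (negPf tn) orbF => zt.
    by rewrite (eqz m t') ?lw // addrK.
  case: (s =P m) => [->|/eqP sm]; first exact: mrE.
  have ys : ~~ loc y s by rewrite ly ffunE (negPf sm) orbF.
  by rewrite (eqw s t) ?lw // (mrE t omt).
have sW := two_step_supp ts km.
have Wm t : om t -> W k m t = r k t by move=> omt; rewrite maskE // mxE eqxx.
split; last by rewrite mf_mk // Wm // /r eqxx.
apply/andP; split; apply/covers_relP; rewrite loc_mk // mf_mk //.
  split=> // s t; rewrite ly ffunE negb_or => /andP[oms sm] omt.
  by rewrite Wm // maskE // mxE (negPf sm).
split=> // s t oms zt; have omt : om t by rewrite ffunE zt.
have tn : t != n by apply: contraNneq zn => <-.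
rewrite maskE // mxE; have [->|sm] := eqVneq s m.
  by rewrite Wm // /r eqxx (negPf tn) subrK.
rewrite maskE // mxE (negPf sm) /r eqxx (negPf tn).
have ys : ~~ loc y s by rewrite ly ffunE (negPf sm) orbF.
have /implyP/(_ ys)/implyP/(_ zt)/eqP -> := eqyz s t; ring.
Qed.

End TwoStep.

Lemma two_stepC m n y z : two_step m n y z = two_step n m y z.
Proof.
rewrite /two_step andbCA; do 2 congr (_ && _); congr (_ && _).
  by congr (_ == _); apply/ffunP=> i; rewrite !ffunE orbAC.
by apply: eq_forallb => s; apply: eq_forallb => t; rewrite addrAC.
Qed.

(** A cover [y] of [z] is determined by its column [c] at [m]. That it also covers [z'] is the rank
    one condition on the difference; row [m] of this condition holds trivially because [c m = 0]. *)
Lemma card_common_up m z z' : ~~ loc z m -> loc z' = loc z ->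
  #|[pred y | covers x m y z && covers x m y z']| =
  #|[pred c | in_col (loc z) m c &&
      (mf z' - mf z == (c + delta_mx m 0) *m row m (mf z' - mf z))]|.
Proof.
move=> zm lz'; pose mu := loc_up (loc z) m.
have mum : mu m by rewrite ffunE eqxx orbT.
have mus s : ~~ mu s -> s != m /\ ~~ loc z s.
  by rewrite ffunE negb_or => /andP[].
pose Y (c : 'cV[F]_N) := mask mu (\matrix_(s,
  t) if t == m then c s 0 else mf z s t - c s 0 * mf z m t).
have sY c : in_col (loc z) m c -> supported_in_B mu (Y c).
  move=> /in_colP cP; apply: mask_supp => s t ms mt; rewrite mxE;
    case: (t =P m) => [-> /cP[]//|_].
  have [->|/mf_supp[_ _ lt]] := eqVneq (mf z s t) 0; last by [].
  by rewrite sub0r oppr_eq0 mulf_eq0 negb_or => /andP[/cP[_ +] /mf_supp[_ _]]; apply: ltn_trans.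
have eqP1 (c : 'cV[F]_N) : in_col (loc z) m c ->
   (forall s t, ~~ mu s -> loc z t ->
     mf z' s t = mf z s t - c s 0 * mf z m t + c s 0 * mf z' m t) <->
   mf z' - mf z = (c + delta_mx m 0) *m row m (mf z' - mf z).
  move=> cC; have cm := in_col_m cC; split=> [h|/matrixP h s t ms zt]; last first.
    have [sm zs] := mus s ms; have := h s t; rewrite !mxE big_ord1 !mxE (negPf sm) /= addr0.
    by move/eqP; rewrite subr_eq => /eqP ->; ring.
  apply/matrixP=> s t; rewrite !mxE big_ord1 !mxE.
  have [->|sm] := eqVneq s m; first by rewrite cm add0r mul1r.
  rewrite /= addr0; have [zt|zt] := boolP (loc z t); last first.
    have z0 i : mf z i t = 0 by apply: contraNeq zt => /mf_supp[].
    have z0' i : mf z' i t = 0 by apply: contraNeq zt => /mf_supp[]; rewrite lz'.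
    by rewrite !z0 !z0' subrr mulr0.
  have [zs|zs] := boolP (loc z s); last by rewrite h // ?ffunE ?negb_or ?zs //; ring.
  have z0 : mf z s t = 0 by apply: contraTeq zs => /mf_supp[].
  have z0' : mf z' s t = 0 by apply: contraTeq zs => /mf_supp[]; rewrite lz'.
  have c0 : c s 0 = 0 by apply: contraTeq zs => /(in_colP _ _ _ cC)[].
  by rewrite z0 z0' c0 subrr mul0r.
apply: (card_bij (f := fun y => col m (mf y)) (g := fun c => mk mu (Y c))).
  move=> y /andP[/covers_relP[_ ly eqz] /covers_relP[_ _ eqz']].
  have cC : in_col (loc z) m (col m (mf y)).
    apply/in_colP=> s; rewrite mxE => /mf_supp[+ _ ->]; rewrite ly ffunE negb_or.
    by case/andP.
  split.
    apply/andP; split=> //; apply/eqP/eqP1 => // s t ms zt; rewrite mxE eqz ?ly //.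
    by rewrite eqz' ?ly ?lz' // addrK.
  apply/esym/form_eq => //; first exact: sY.
  move=> s t ms mt; rewrite maskE // !mxE; case: (t =P m) => [->//|/eqP tm].
  move: mt; rewrite ffunE (negPf tm) orbF => zt.
  by rewrite eqz ?ly // addrK.
move=> c /andP[cC /eqP /(eqP1 c cC) h].
have YE s t : ~~ mu s -> mu t -> Y c s t = if t == m then c s 0 else mf z s t - c s 0 * mf z m t.
  by move=> ms mt; rewrite maskE // mxE.
split; last first.
  rewrite mf_mk ?sY //; apply/colP=> s; rewrite mxE.
  have [ms|ms] := boolP (mu s); last by rewrite YE // eqxx.
  rewrite mxE ms /=; apply/esym; apply: contraTeq ms => /(in_colP _ _ _ cC)[zs lt].
  by rewrite ffunE negb_or zs -val_eqE /= ltn_eqF.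
have tm t : loc z t -> mu t /\ (t == m) = false.
  by move=> zt; rewrite ffunE zt; split=> //; apply: contraNF zm => /eqP <-.
apply/andP; split; apply/covers_relP; rewrite loc_mk ?sY // mf_mk ?sY // ?lz';
  split=> // s t ms zt.
  by have [mt ntm] := tm t zt; rewrite !YE // eqxx ntm subrK.
by have [mt ntm] := tm t zt; rewrite !YE // eqxx ntm h.
Qed.

(** Dual to the preceding count: a space covered by [y] is determined by its row [d] at [m]. *)
Lemma card_common_down m y y' : loc y m -> loc y' = loc y ->
  #|[pred z | covers x m y z && covers x m y' z]| =
  #|[pred d | in_row (loc y) m d &&
      (mf y' - mf y == col m (mf y' - mf y) *m (delta_mx 0 m - d))]|.
Proof.
move=> ym ly'; pose nu : {ffun 'I_N -> bool} := [ffun i => loc y i && (i != m)].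
have num : ~~ nu m by rewrite ffunE eqxx andbF.
have upnu : loc_up nu m = loc y.
  apply/ffunP=> i; rewrite !ffunE; case: eqP => [->|_]; first by rewrite orbT ym.
  by rewrite orbF andbT.
have nuE t : nu t -> loc y t /\ t != m by rewrite ffunE => /andP[].
pose Z (d : 'rV[F]_N) := mask nu (\matrix_(s,
  t) if s == m then d 0 t else mf y s t + mf y s m * d 0 t).
have sZ d : in_row (loc y) m d -> supported_in_B nu (Z d).
  move=> /in_rowP dP; apply: mask_supp => s t ms mt; rewrite mxE;
    case: (s =P m) => [-> /dP[]//|_].
  have [->|/mf_supp[_ _ lt]] := eqVneq (mf y s t) 0; last by [].
  by rewrite add0r mulf_eq0 negb_or => /andP[/mf_supp[_ _ +] /dP[_]]; apply: ltn_trans.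
have eqP1 (d : 'rV[F]_N) : in_row (loc y) m d ->
   (forall s t, ~~ loc y s -> nu t ->
     mf y s t + mf y s m * d 0 t = mf y' s t + mf y' s m * d 0 t) <->
   mf y' - mf y = col m (mf y' - mf y) *m (delta_mx 0 m - d).
  move=> dD; have dm := in_row_m dD; split=> [h|/matrixP h s t ms nt]; last first.
    have [yt tm] := nuE t nt; have := h s t; rewrite !mxE big_ord1 !mxE (negPf tm) /= sub0r.
    by move/eqP; rewrite subr_eq => /eqP ->; ring.
  apply/matrixP=> s t; rewrite !mxE big_ord1 !mxE.
  have [->|tm] := eqVneq t m; first by rewrite dm subr0 mulr1.
  rewrite /= sub0r; have [ys|ys] := boolP (loc y s).
    have z0 i : mf y s i = 0 by apply: contraTeq ys => /mf_supp[].
    have z0' i : mf y' s i = 0 by apply: contraTeq ys => /mf_supp[]; rewrite ly'.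
    by rewrite !z0 !z0' subrr mul0r.
  have [yt|yt] := boolP (loc y t).
    have := h s t ys; rewrite ffunE yt tm => /(_ isT)/eqP; rewrite -subr_eq => /eqP <-; ring.
  have z0 : mf y s t = 0 by apply: contraNeq yt => /mf_supp[].
  have z0' : mf y' s t = 0 by apply: contraNeq yt => /mf_supp[]; rewrite ly'.
  have d0 : d 0 t = 0 by apply: contraNeq yt => /(in_rowP _ _ _ dD)[].
  by rewrite z0 z0' d0 subrr oppr0 mulr0.
have lznu z : ~~ loc z m -> loc y = loc_up (loc z) m -> loc z = nu.
  move=> zm ly; apply/ffunP=> i; rewrite [RHS]ffunE ly ffunE.
  case: eqP => [->|_]; first by rewrite andbF (negPf zm).
  by rewrite orbF andbT.
apply: (card_bij (f := fun z => row m (mf z)) (g := fun d => mk nu (Z d))).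
  move=> z /andP[/covers_relP[zm ly eqz] /covers_relP[_ _ eqz']].
  have lz := lznu z zm ly.
  have dD : in_row (loc y) m (row m (mf z)).
    apply/in_rowP=> s; rewrite mxE => /mf_supp[_ + ->]; rewrite lz.
    by case/nuE.
  split.
    apply/andP; split=> //; apply/eqP/eqP1 => // s t ms nt; rewrite mxE -eqz ?lz //.
    by rewrite -eqz' ?ly' ?lz.
  apply/esym/form_eq => //; first exact: sZ.
  move=> s t ms mt; rewrite maskE // !mxE; case: (s =P m) => [->//|/eqP sm].
  by rewrite eqz ?lz //; apply: contra ms; rewrite ffunE sm andbT.
move=> d /andP[dD /eqP /(eqP1 d dD) h].
have ZE s t : ~~ nu s -> nu t -> Z d s t = if s == m then d 0 t else mf y s t + mf y s m * d 0 t.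
  by move=> ms mt; rewrite maskE // mxE.
split; last first.
  rewrite mf_mk ?sZ //; apply/rowP=> t; rewrite mxE.
  have [nt|nt] := boolP (nu t); first by rewrite ZE // eqxx.
  rewrite mxE (negPf nt) andbF; apply/esym; apply: contraNeq nt => /(in_rowP _ _ _ dD)[yt lt].
  by rewrite ffunE yt -val_eqE /= gtn_eqF.
have sm s : ~~ loc y s -> ~~ nu s /\ (s == m) = false.
  by move=> ys; rewrite ffunE (negPf ys); split=> //; apply: contraNF ys => /eqP ->.
apply/andP; split; apply/covers_relP; rewrite loc_mk ?sZ // mf_mk ?sZ // ?ly';
  split=> // s t ys nt.
  by have [ns nsm] := sm s ys; rewrite !ZE // eqxx nsm.
by have [ns nsm] := sm s ys; rewrite !ZE // eqxx nsm h.
Qed.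

End Counting.

(** * The operators on the basis of characters *)

Section Operators.
Variables (R : realType) (F : finFieldType) (N : nat) (H : vectType F).
Variable x : 'I_N.+1 -> {vspace H}.
Hypothesis hx : full_flag x.
Variable v : N.-tuple H.
Hypothesis hv : adapted_basis x v.
Variable chi : F -> R[i].
Hypothesis hchi : nontrivial_character chi.
Implicit Types (y z w : {vspace H}) (mu nu : {ffun 'I_N -> bool}) (Y Z : 'M[F]_N).

Local Notation loc := (locn x).
Local Notation mf := (mform x v).
Local Notation mk mu Y := (form_space v mu Y).
Local Notation n := #|{: {vspace H}}|.
Local Notation V := 'cV[R[i]]_n.
Local Notation chiv := (chi_vec x v chi).
Local Notation L := (Lmx x R).
Local Notation Rm := (Rmx x R).
Local Notation E := (Estar x R).

Let chi0 : chi 0 = 1. Proof. by case: hchi. Qed.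
Let chiD a b : chi (a + b) = chi a * chi b. Proof. by case: hchi. Qed.
Let chi_nt : exists a, chi a <> 1. Proof. by case: hchi. Qed.

Definition ev (u : V) y := u (enum_rank y) 0.

Lemma ev_inj (u u' : V) : (forall y, ev u y = ev u' y) -> u = u'.
Proof. by move=> h; apply/colP=> i; have := h (enum_val i); rewrite /ev enum_valK. Qed.

Lemma ev_vecP f y : ev (vecP f) y = f y.
Proof. by rewrite /ev mxE enum_rankK. Qed.

Lemma evD u u' y : ev (u + u') y = ev u y + ev u' y. Proof. by rewrite /ev mxE. Qed.
Lemma evZ a u y : ev (a *: u) y = a * ev u y. Proof. by rewrite /ev mxE. Qed.
Lemma ev0 y : ev 0 y = 0. Proof. by rewrite /ev mxE. Qed.
Lemma ev_sum I (r : seq I) (P : pred I) (G : I -> V) y :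
  ev (\sum_(i <- r | P i) G i) y = \sum_(i <- r | P i) ev (G i) y.
Proof. by rewrite /ev summxE. Qed.

Lemma ev_neq0 u : u != 0 -> exists y, ev u y != 0.
Proof.
move=> u0; apply/existsP; apply: contraR u0; rewrite negb_exists => /forallP h.
by apply/eqP/ev_inj=> y; rewrite ev0; apply/eqP; have := h y; rewrite negbK.
Qed.

Lemma sum_enum_val (T : nmodType) (f : {vspace H} ->
  T) : \sum_(i < n) f (enum_val i) = \sum_y f y.
Proof.
by rewrite [RHS](reindex (@enum_val _ (mem {: {vspace H}}))) //; apply/onW_bij/enum_val_bij.
Qed.

Lemma matP_mul (f g : {vspace H} -> {vspace H} -> R[i]) :
  matP f *m matP g = matP (fun y z => \sum_w f y w * g w z).
Proof.
apply/matrixP=> i j; rewrite !mxE -sum_enum_val; apply: eq_bigr => k _.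
by rewrite !mxE.
Qed.

Lemma ev_matP (f : {vspace H} -> {vspace H} ->
  R[i]) u y : ev (matP f *m u) y = \sum_z f y z * ev u z.
Proof.
rewrite /ev mxE -sum_enum_val; apply: eq_bigr => k _.
by rewrite !mxE enum_rankK enum_valK.
Qed.

Lemma eq_matP (f g : {vspace H} -> {vspace H} -> R[i]) : (forall y z, f y z = g y z) ->
  matP f = matP g.
Proof. by move=> h; apply/matrixP=> i j; rewrite !mxE. Qed.

Lemma RmE m : Rm m = matP (fun y z => (covers x m y z)%:R).
Proof. by apply/matrixP=> i j; rewrite !mxE. Qed.

Lemma ev_R m u y : ev (Rm m *m u) y = \sum_(z | covers x m y z) ev u z.
Proof.
rewrite RmE ev_matP [RHS]big_mkcond; apply: eq_bigr => z _.
by case: ifP; rewrite ?mul1r ?mul0r.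
Qed.

Lemma ev_L m u y : ev (L m *m u) y = \sum_(z | covers x m z y) ev u z.
Proof.
rewrite /Lmx ev_matP [RHS]big_mkcond; apply: eq_bigr => z _.
by case: ifP; rewrite ?mul1r ?mul0r.
Qed.

Lemma ev_E mu u y : ev (E mu *m u) y = if loc y == mu then ev u y else 0.
Proof.
rewrite /Estar ev_matP (bigD1 y) //= eqxx big1 ?addr0 => [|z zy].
  by rewrite (locnE x); case: ifP; rewrite ?mul1r ?mul0r.
by rewrite eq_sym (negPf zy) mul0r.
Qed.

Lemma covers_loc m y z : covers x m y z -> ~~ loc z m /\ loc y = loc_up (loc z) m.
Proof. by case/(covers_relP hx hv). Qed.

(** Both products are nonzero multiples of the matrix of [two_step], a relation symmetric in the two
    indices. *)
Lemma R_comm m p : m != p -> exists c, Rm m *m Rm p = c *: (Rm p *m Rm m).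
Proof.
move=> mp; set k := fun m p : 'I_N => (#|[pred k : F | (k != 0)%R ==> (m < p)%N]|%:R : R[i]).
have RR m' p' : m' != p' -> Rm m' *m Rm p' = k m' p' *: matP (fun y z =>
  (two_step x v m' p' y z)%:R).
  move=> mp'; rewrite !RmE matP_mul; apply/matrixP=> i j;
    rewrite !mxE -natrM -(card_two_step hx hv _ _ mp').
  rewrite -sum1_card natr_sum [RHS]big_mkcond; apply: eq_bigr => w _ /=.
  by rewrite -natrM mulnb inE /=; case: ifP.
have k0 m' p' : k m' p' != 0.
  rewrite pnatr_eq0 -lt0n; apply/card_gt0P; exists 0; by rewrite inE eqxx.
exists (k m p / k p m); rewrite RR // RR 1?eq_sym // scalerA divfK //.
by congr (_ *: _); apply: eq_matP => y z; rewrite two_stepC.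
Qed.

Lemma LR_comm m p : m != p -> L m *m Rm p = Rm p *m L m.
Proof.
move=> mp; rewrite !RmE /Lmx !matP_mul; apply: eq_matP => z' z.
rewrite (eq_bigr (fun w => (covers x m w z' && covers x p w z : nat)%:R)); last first.
  by move=> w _; rewrite -natrM mulnb.
rewrite [RHS](eq_bigr (fun w => (covers x p z' w && covers x m z w : nat)%:R)); last first.
  by move=> w _; rewrite -natrM mulnb.
by rewrite -!natr_sum (covers_exchange hx hv).
Qed.

Lemma RR0 m : Rm m *m Rm m = 0.
Proof.
rewrite !RmE matP_mul; apply/matrixP=> i j; rewrite !mxE big1 // => w _.
rewrite -natrM mulnb; case: andP => // -[/covers_loc[wm _] /covers_loc[_ lw]].
by move: wm; rewrite lw ffunE eqxx orbT.
Qed.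

(** One formula covers both cases of [chi_vec]: at a constant location the only supported matrix is
    0, so the class is a single space and the exponent is trivial. *)
Lemma ev_chi y z : ev (chiv y) z = if loc z == loc y then chi (\tr (mf y *m (mf z)^T)) else 0.
Proof.
rewrite /chi_vec -(locnE x) -(mformE x v); case: ifP => cl; rewrite ev_vecP //.
case: (eqVneq (loc z) (loc y)) => [lzy|lzy]; last by case: eqP => // zy; rewrite zy eqxx in lzy.
have f0 mu (Y : 'M[F]_N) : constant_loc mu -> supported_in_B mu Y -> Y = 0.
  move=> cm sY; apply/matrixP=> s t; rewrite mxE (supported0 sY) //;
    apply/negP=> /and3P[mus mut _].
  by case/orP: cm => /eqP/setP; [move/(_ s)|move/(_ t)]; rewrite !inE ?mus ?mut.
have m0 y' : loc y' = loc y -> mf y' = 0.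
  by move=> ly; apply: (f0 (loc y)) => //; rewrite -ly; apply: (mform_supp hv).
have -> : z = y by rewrite -(form_mform hv z) -(form_mform hv y) lzy !m0.
by rewrite eqxx m0 // mul0mx mxtrace0 chi0.
Qed.

Definition typ y := matrix_type (loc y) (mf y).

Lemma typE y : subspace_type x v y = typ y.
Proof.
rewrite /subspace_type /typ -(locnE x) -(mformE x v); case: ifP => // cl; apply/esym/setP=> i.
rewrite inE in_set0; apply/negbTE/exists_inP=> -[[s t] + _].
rewrite sigmaE ?(mform_supp hv) // => /and4P[mus mut _ _].
by case/orP: cl => /eqP/setP; [move/(_ s)|move/(_ t)]; rewrite !inE ?mus ?mut.
Qed.

Lemma sum_loc (T : nmodType) mu (f : {vspace H} -> T) :
  \sum_(z | loc z == mu) f z = \sum_(Z | supported_in_B mu Z) f (mk mu Z).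
Proof.
rewrite (reindex_onto (fun Z => mk mu Z) mf) => [|z /eqP <-]; last exact: (form_mform hv).
apply: eq_bigl => Z; apply/idP/idP => [/andP[/eqP lZ /eqP <-]|sZ].
  by rewrite -{1}lZ; apply: (mform_supp hv).
by rewrite (loc_mk hv) // (mf_mk hv) // !eqxx.
Qed.

Lemma suppB_supp mu (X Y : 'M[F]_N) : supported_in_B mu Y ->
  supported_in_B mu (X + Y) = supported_in_B mu X.
Proof. exact: suppDr. Qed.

(** The unnormalised Fourier coefficient of [u] at [y]. By [coef_chi] these functionals are
    orthogonal to the other characters, which gives the independence in [chi_basisP]. *)
Definition coef y (u : V) := \sum_(z | loc z == loc y) chi (- \tr (mf y *m (mf z)^T)) * ev u z.

Lemma coef_chi y y' : coef y (chiv y') =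
  if y == y' then #|[pred Z : 'M[F]_N | supported_in_B (loc y) Z]|%:R else 0.
Proof.
rewrite /coef; have [ly|ly] := eqVneq (loc y') (loc y); last first.
  rewrite big1 => [|z /eqP lz]; last by rewrite ev_chi lz eq_sym (negPf ly) mulr0.
  by case: eqP => // yy; rewrite yy eqxx in ly.
rewrite sum_loc (eq_bigr (fun Z => chi (\tr ((mf y' - mf y) *m Z^T)))) => [|Z sZ]; last first.
  by rewrite ev_chi (loc_mk hv) // ly eqxx (mf_mk hv) // -chiD mulmxBl linearB /= addrC.
rewrite (char_sum chi0 chiD chi_nt (fun s t => (s, t) \in Bset (loc y)));
  congr (if _ then _ else _).
apply/'forall_forallP/eqP => [h|<- s t]; last by rewrite subrr mxE eqxx implybT.
rewrite -(form_mform hv y) -(form_mform hv y') ly; congr (mk _ _); apply/esym/eqP.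
rewrite -subr_eq0; apply/eqP/matrixP=> s t; rewrite [RHS]mxE.
have [Bst|nB] := boolP ((s, t) \in Bset (loc y)); first by apply/eqP; apply: (implyP (h s t)).
have sub : supported_in_B (loc y) (mf y' - mf y).
  by apply: suppB; [rewrite -ly|]; apply: (mform_supp hv).
by apply: (supp0E (Q := fun s t => (s, t) \in Bset (loc y)) sub).
Qed.

Lemma coefP a u u' y : coef y (a *: u + u') = a * coef y u + coef y u'.
Proof.
rewrite /coef mulr_sumr -big_split; apply: eq_bigr => z _ /=.
by rewrite evD evZ mulrDr mulrCA.
Qed.

Definition chi_basis : n.-tuple V := [tuple chiv (enum_val i) | i < n].

Lemma chi_basisP : basis_of fullv chi_basis.
Proof.
have fr : free chi_basis.
  apply/freeP=> k; rewrite (eq_bigr (fun i => k i *: chiv (enum_val i))) => [k0 i|i _];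
    last first.
    by rewrite -tnth_nth tnth_mktuple.
  have : coef (enum_val i) (\sum_j k j *: chiv (enum_val j)) = 0.
    by rewrite k0 -[0](scaler0 V 0) -[0 *: 0]addr0 coefP mul0r add0r /coef big1 // => z _;
      rewrite ev0 mulr0.
  have cs (r : seq 'I_n) : coef (enum_val i) (\sum_(j <- r) k j *: chiv (enum_val j)) =
      \sum_(j <- r) k j * coef (enum_val i) (chiv (enum_val j)).
    elim: r => [|j r IH]; last by rewrite !big_cons coefP IH.
    by rewrite !big_nil /coef big1 // => z _; rewrite ev0 mulr0.
  rewrite cs (bigD1 i) //.
  rewrite big1 => [|j ji]; last first.
    by rewrite coef_chi (inj_eq enum_val_inj) eq_sym (negPf ji) mulr0.
  rewrite coef_chi eqxx => k_eq0.
  have : k i * #|[pred Z : 'M[F]_N | supported_in_B (loc (enum_val i)) Z]|%:R + 0 = 0 by [].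
  rewrite addr0; move/eqP; rewrite mulf_eq0 pnatr_eq0 => /orP[/eqP //|].
  rewrite (cardD1 0) inE /= (_ : supported_in_B _ _) //.
  by apply/'forall_forallP=> s t; rewrite mxE eqxx.
by rewrite basisEfree fr subvf size_tuple dimvf /= /dim /= muln1.
Qed.

Definition cf y (u : V) : R[i] := coord chi_basis (enum_rank y) u.

Lemma cf_expand u : u = \sum_y cf y u *: chiv y.
Proof.
rewrite [LHS](coord_basis chi_basisP) ?memvf // -[RHS]sum_enum_val; apply: eq_bigr => i _.
by rewrite /cf enum_valK -tnth_nth tnth_mktuple.
Qed.

Lemma cf_chi y y' : cf y (chiv y') = (y == y')%:R.
Proof.
have -> : chiv y' = chi_basis`_(enum_rank y') by rewrite -tnth_nth tnth_mktuple enum_rankK.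
by rewrite /cf coord_free ?(basis_free chi_basisP) // (inj_eq enum_rank_inj) eq_sym.
Qed.

Lemma E_chi mu y : E mu *m chiv y = (loc y == mu)%:R *: chiv y.
Proof.
apply: ev_inj => z; rewrite ev_E evZ ev_chi.
case: (eqVneq (loc z) (loc y)) => [->|_]; first by case: eqP; rewrite ?mul1r ?mul0r.
by rewrite mulr0 if_same.
Qed.

Lemma R_chi0 m y : loc y m -> Rm m *m chiv y = 0.
Proof.
move=> ym; apply: ev_inj => z; rewrite ev_R ev0 big1 // => w /covers_loc[wm _].
by rewrite ev_chi; case: eqP => // lw; rewrite lw ym in wm.
Qed.

Lemma L_chi0 m y : ~~ loc y m -> L m *m chiv y = 0.
Proof.
move=> ym; apply: ev_inj => z; rewrite ev_L ev0 big1 // => w /covers_loc[_ lw].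
rewrite ev_chi; case: eqP => // ly; move: ym; by rewrite -ly lw ffunE eqxx orbT.
Qed.

Lemma chi_shift y X Z : chi (\tr (mf y *m (X + Z)^T)) = chi (\tr (mf y *m X^T)) * chi (\tr (mf y
  *m Z^T)).
Proof. by rewrite linearD /= mulmxDr linearD chiD. Qed.

(** A kernel depending only on the difference of matrix forms is a convolution on [P_mu].
    Substituting the matrix of [z'] by [X] plus that of [z], and using multiplicativity of [chi],
    exhibits [chi_y] as an eigenvector. *)
Lemma sum_common (I : finType) (P : pred I) (e : 'M[F]_N -> I -> bool) y z : loc z = loc y ->
  \sum_(z' | loc z' == loc z) #|[pred c | P c && e (mf z' - mf z) c]|%:R * ev (chiv y) z' =
  (\sum_(c | P c) \sum_(X | supported_in_B (loc y) X && e X c) chi (\tr (mf y *m X^T))) * ev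
    (chiv y) z.
Proof.
move=> lz; rewrite lz sum_loc (reindex_inj (addIr (mf z))) mulr_suml.
have sz : supported_in_B (loc y) (mf z) by rewrite -lz; apply: (mform_supp hv).
rewrite (eq_big (supported_in_B (loc y))
  (fun X => \sum_(c | P c && e X c) chi (\tr (mf y *m X^T)) * ev (chiv y) z)); first last.
- move=> X sX; have sX' : supported_in_B (loc y) X by rewrite -(suppB_supp X sz).
  rewrite (mf_mk hv) // addrK ev_chi (loc_mk hv) // eqxx (mf_mk hv) // chi_shift.
  by rewrite [in RHS]ev_chi lz eqxx mulr_natl -sumr_const; apply: eq_bigl => c; rewrite inE.
- by move=> X; rewrite suppB_supp.
rewrite (exchange_big_dep P) /= => [|X c _ /andP[] //]; apply: eq_bigr => c Pc.
by rewrite mulr_suml; apply: eq_bigl => X; rewrite Pc.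
Qed.

Lemma LR_chi m y : ~~ loc y m ->
  L m *m (Rm m *m chiv y) = theta_row chi (loc y) m (mf y) *: chiv y.
Proof.
move=> ym; apply: ev_inj => z; rewrite evZ ev_L.
rewrite (eq_bigr _ (fun w _ => ev_R m (chiv y) w)).
have same w z' : covers x m w z -> covers x m w z' -> loc z' = loc z.
  move=> /covers_loc[zm lw] /covers_loc[zm' lw']; apply/ffunP=> i.
  have := congr1 (fun f : {ffun 'I_N -> bool} => f i) (etrans (esym lw) lw'); rewrite !ffunE.
  by case: eqP => [->|_]; [rewrite (negPf zm) (negPf zm')|rewrite !orbF].
have [lz|lz] := eqVneq (loc z) (loc y); last first.
  rewrite [in RHS]ev_chi (negPf lz) mulr0 big1 // => w cw; rewrite big1 // => z' cw'.
  by rewrite ev_chi (same w) // (negPf lz).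
rewrite /theta_row -(sum_common (in_col (loc y) m) (fun X c =>
  X == (c + delta_mx m 0) *m row m X) lz).
rewrite (exchange_big_dep (fun z' => loc z' == loc z)) /= => [|w z' c1 c2];
  last by apply/eqP/(same w).
apply: eq_bigr => z' /eqP lz'; rewrite -lz -(card_common_up hx hv) ?lz' ?lz //.
by rewrite mulr_natl -sumr_const; apply: eq_bigl => w; rewrite inE.
Qed.

Lemma RL_chi m y : loc y m ->
  Rm m *m (L m *m chiv y) = theta_col chi (loc y) m (mf y) *: chiv y.
Proof.
move=> ym; apply: ev_inj => z; rewrite evZ ev_R.
rewrite (eq_bigr _ (fun w _ => ev_L m (chiv y) w)).
have same w z' : covers x m z w -> covers x m z' w -> loc z' = loc z.
  by move=> /covers_loc[zm ->] /covers_loc[zm' ->].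
have [lz|lz] := eqVneq (loc z) (loc y); last first.
  rewrite [in RHS]ev_chi (negPf lz) mulr0 big1 // => w cw; rewrite big1 // => z' cw'.
  by rewrite ev_chi (same w) // (negPf lz).
rewrite /theta_col -(sum_common (in_row (loc y) m) (fun X d =>
  X == col m X *m (delta_mx 0 m - d)) lz).
rewrite (exchange_big_dep (fun z' => loc z' == loc z)) /= => [|w z' c1 c2];
  last by apply/eqP/(same w).
apply: eq_bigr => z' /eqP lz'; rewrite -lz -(card_common_down hx hv) ?lz' ?lz //.
by rewrite mulr_natl -sumr_const; apply: eq_bigl => w; rewrite inE.
Qed.

Lemma theta_row_typ m y y' : ~~ loc y m -> loc y' = loc y -> typ y' = typ y ->
  theta_row chi (loc y') m (mf y') = theta_row chi (loc y) m (mf y).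
Proof.
move=> ym ly; rewrite /typ ly => ty; apply: (theta_row_type chi0 chiD chi_nt) => //.
  by rewrite -ly; apply: (mform_supp hv).
exact: (mform_supp hv).
Qed.

Lemma theta_row_typ0 m y : ~~ loc y m ->
  (theta_row chi (loc y) m (mf y) == 0) = (m \in typ y).
Proof. by move=> ym; apply: (theta_row_eq0 chi0 chiD chi_nt) => //; apply: (mform_supp hv). Qed.

Lemma theta_col_typ0 m y : loc y m ->
  (theta_col chi (loc y) m (mf y) == 0) = (m \in typ y).
Proof. by move=> ym; apply: (theta_col_eq0 chi0 chiD chi_nt) => //; apply: (mform_supp hv). Qed.

Lemma admissible_typ y : admissible (loc y) (typ y).
Proof. by apply/admissible_type/(mform_supp hv). Qed.

Lemma dim_loc y : \dim y = (\sum_i loc y i)%N.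
Proof. by rewrite locnE (dim_location hx hv). Qed.

Definition conj_mx p q (A : 'M[R[i]]_(p, q)) := map_mx Num.conj A.

Lemma mx_pos p (u : 'cV[R[i]]_p) : (conj_mx u)^T *m u = 0 -> u = 0.
Proof.
move/matrixP/(_ 0 0); rewrite !mxE => s0; apply/colP=> i; rewrite mxE.
have h : \sum_j `|u j 0| ^+ 2 = 0.
  by rewrite -[RHS]s0; apply: eq_bigr => j _; rewrite !mxE normCK mulrC.
move/eqP: h; rewrite psumr_eq0 => [/allP/(_ i (mem_index_enum i))/=|j _]; last exact: exprn_ge0.
by rewrite sqrf_eq0 normr_eq0 => /eqP.
Qed.

Lemma conj_mxM p q r (A : 'M[R[i]]_(p, q)) (B : 'M_(q,
  r)) : conj_mx (A *m B) = conj_mx A *m conj_mx B.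
Proof. exact: map_mxM. Qed.

Lemma conj_matP (f : {vspace H} -> {vspace H} -> bool) :
  conj_mx (matP (fun y z => (f y z)%:R)) = matP (fun y z => (f y z)%:R) :> 'M[R[i]]_n.
Proof. by apply/matrixP=> i j; rewrite !mxE rmorph_nat. Qed.

Lemma conj_L m : conj_mx (L m) = L m. Proof. exact: conj_matP. Qed.
Lemma conj_R m : conj_mx (Rm m) = Rm m. Proof. by rewrite RmE conj_matP. Qed.

(** [R_m] is the adjoint of the real matrix [L_m], so the hypothesis makes the norm of [L_m u]
    vanish. *)
Lemma RL_eq0 m (u : V) : Rm m *m (L m *m u) = 0 -> L m *m u = 0.
Proof. by move=> h; apply: mx_pos; rewrite conj_mxM conj_L trmx_mul -mulmxA h mulmx0. Qed.

End Operators.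

(** * Modules *)

(** A subspace inside [P] is enlarged by a vector of [P] outside it as long as there is one; the
    dimension of the ambient space bounds the number of steps. *)
Lemma subspace_of_pred (K : fieldType) (vT : vectType K) (P : vT -> Prop) :
  P 0 -> (forall a u u', P u -> P u' -> P (a *: u + u')) ->
  exists U : {vspace vT}, forall u, u \in U <-> P u.
Proof.
move=> P0 Plin.
have step k : (exists U : {vspace vT}, forall u, u \in U <-> P u) \/
    exists2 U : {vspace vT}, (forall u, u \in U -> P u) & (k <= \dim U)%N.
  elim: k => [|k [IH|[U sU dU]]]; [|by left|].
    by right; exists 0%VS => // u; rewrite memv0 => /eqP ->.
  have [[u Pu nu]|nex] := pselect (exists2 u, P u & u \notin U).
    right; exists (U + <[u]>)%VS => [w|].
      case/memv_addP=> w1 /sU Pw1 [_ /vlineP[a ->] ->].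
      by rewrite addrC; apply: Plin.
    apply: leq_ltn_trans dU _; rewrite ltn_neqAle dimvS ?addvSl // andbT.
    apply: contra nu => /eqP dd; have /eqP ->
      : U == (U + <[u]>)%VS by rewrite eqEdim addvSl dd leqnn.
    by apply: (subvP (addvSr _ _)); apply: memv_line.
  left; exists U => u; split=> [/sU//|Pu].
  by apply/negPn/negP=> nu; apply: nex; exists u.
have [//|[U _]] := step (\dim {:vT}).+1.
by rewrite ltnNge dimvS ?subvf.
Qed.

Lemma sum_delta (T : finType) (K : pzRingType) (a : T -> K) y : \sum_z a z * (y == z)%:R = a y.
Proof.
rewrite (bigD1 y) //= eqxx mulr1 big1 ?addr0 // => z zy.
by rewrite eq_sym (negPf zy) mulr0.
Qed.

Section Modules.
Variables (R : realType) (F : finFieldType) (N : nat) (H : vectType F).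
Variable x : 'I_N.+1 -> {vspace H}.
Hypothesis hx : full_flag x.
Variable v : N.-tuple H.
Hypothesis hv : adapted_basis x v.
Variable chi : F -> R[i].
Hypothesis hchi : nontrivial_character chi.

Local Notation loc := (locn x).
Local Notation n := #|{: {vspace H}}|.
Local Notation V := 'cV[R[i]]_n.
Local Notation chiv := (chi_vec x v chi).
Local Notation L := (Lmx x R).
Local Notation Rm := (Rmx x R).
Local Notation E := (Estar x R).
Local Notation Hal := (Halg x R).
Local Notation typ := (typ x v).
Local Notation cf := (cf x v chi).

Implicit Types (y z : {vspace H}) (mu nu : {ffun 'I_N -> bool}) (lam : {set 'I_N}) (u w : V).
Implicit Types (W : {vspace V}) (s : seq 'I_N).

Lemma Hal_L m : Hal (L m). Proof. by apply: ga_gen; apply: Hgen_L. Qed.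
Lemma Hal_R m : Hal (Rm m). Proof. by apply: ga_gen; apply: Hgen_R. Qed.
Lemma Hal_E mu : Hal (E mu). Proof. by apply: ga_gen; apply: Hgen_E. Qed.
Lemma Hal0 : Hal 0. Proof. by rewrite -(scale0r 1%:M); apply/ga_scale/ga_one. Qed.

(** The generators are real and transposition exchanges [L_m] and [R_m]. This keeps [h^* h], hence
    the norm of [h u], within reach of the algebra. *)
Lemma Hal_star h : Hal h -> Hal (conj_mx h)^T.
Proof.
elim=> [A [m|m|mu]||a A _ IH|A B _ IHA _ IHB|A B _ IHA _ IHB].
- by rewrite conj_L; apply: Hal_R.
- by rewrite conj_R /Rmx trmxK; apply: Hal_L.
- rewrite /Estar (conj_matP R (fun y z => (y == z) && (location x y == mu))).
  suff -> : (matP (fun y z => ((y == z) && (location x y == mu))%:R))^T = E mu by apply: Hal_E.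
  by apply/matrixP=> i j; rewrite !mxE eq_sym; case: eqP => // ->.
- by rewrite /conj_mx map_mx1 trmx1; apply: ga_one.
- by rewrite /conj_mx map_mxZ linearZ; apply: ga_scale.
- by rewrite /conj_mx map_mxD linearD; apply: ga_add.
by rewrite conj_mxM trmx_mul; apply: ga_mul.
Qed.

(** The block [E*_mu E_lambda V], expressed by the support of [u] in the basis of characters;
    [Eproj_block] and [Eproj_id] give the equivalence. *)
Definition in_block mu lam u := forall y, cf y u != 0 -> loc y = mu /\ typ y = lam.

Lemma in_block_eq mu lam (A B : 'M_n) : (forall y, loc y = mu -> typ y = lam ->
  A *m chiv y = B *m chiv y) ->
  forall u, in_block mu lam u -> A *m u = B *m u.
Proof.
move=> h u bu; rewrite (cf_expand hv hchi u) !mulmx_sumr; apply: eq_bigr => y _.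
rewrite -!scalemxAr; have [->|/bu[ly ty]] := eqVneq (cf y u) 0; first by rewrite !scale0r.
by rewrite h.
Qed.

Lemma cfP y a u u' : cf y (a *: u + u') = a * cf y u + cf y u'.
Proof. by rewrite /cf linearP. Qed.

Lemma cf0 y : cf y 0 = 0. Proof. by rewrite /cf linear0. Qed.

Definition size_loc mu := (\sum_i mu i)%N.
Definition in_dim k u := forall y, ev u y != 0 -> \dim y = k.

Lemma in_block_dim mu lam u : in_block mu lam u -> in_dim (size_loc mu) u.
Proof.
move=> bu y nz; rewrite (dim_loc hx hv) /size_loc.
suff -> : loc y = mu by [].
apply/eqP; apply: contraNT nz => ly; have -> : u = E mu *m u.
  rewrite -[LHS]mul1mx; apply: in_block_eq bu => z lz _.
  by rewrite mul1mx (E_chi hv hchi) lz eqxx scale1r.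
by rewrite ev_E (negPf ly).
Qed.

Lemma covers_dim m y z : covers x m y z -> \dim y = (\dim z).+1.
Proof. by case/and3P=> _ /eqP. Qed.

Lemma in_dim_R k m u : in_dim k u -> in_dim k.+1 (Rm m *m u).
Proof.
move=> du y; rewrite ev_R; have [[z /andP[cz nz]] _|nex] :=
  pselect (exists z, covers x m y z && (ev u z != 0)).
  by rewrite (covers_dim cz) (du _ nz).
rewrite big1 ?eqxx // => z cz; apply/eqP/negPn/negP=> nz; apply: nex; exists z; by rewrite cz.
Qed.

(** Words in the raising operators. Their combinations are stored in [comb] as lists of coefficients
    and words, so that a single list can serve all vectors of a block. *)
Definition Rw s : 'M[R[i]]_n := foldr (fun m A => Rm m *m A) 1%:M s.
Definition comb (B : seq (R[i] * seq 'I_N)) := \sum_(p <- B) p.1 *: Rw p.2.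

Lemma in_dim_Rw (k : nat) s u : in_dim k u -> in_dim (k + size s)%N (Rw s *m u).
Proof.
move=> du; elim: s => [|m s IH] /=; first by rewrite mul1mx addn0.
by rewrite -mulmxA addnS; apply: in_dim_R.
Qed.

(** * Action of the algebra on a column-full block *)

Section Block.
Variables (mu : {ffun 'I_N -> bool}) (lam : {set 'I_N}).
Hypothesis full : column_full mu lam.

Lemma block_L m u : in_block mu lam u -> L m *m u = 0.
Proof.
rewrite -[RHS](mul0mx _ u); apply: in_block_eq => y ly ty; rewrite mul0mx.
have [ym|ym] := boolP (loc y m); last exact: (L_chi0 hx hv hchi).
apply: (@RL_eq0 R F N H x); rewrite (RL_chi hx hv hchi) //; apply/eqP; rewrite scaler_eq0.
rewrite (theta_col_typ0 hv hchi) // ty (subsetP full) // inE -ly ym //.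
Qed.

Lemma block_LR m : exists c, forall u, in_block mu lam u -> L m *m (Rm m *m u) = c *: u.
Proof.
have [[y0 [ly0 ty0]]|nex] := pselect (exists y, loc y = mu /\ typ y = lam); last first.
  exists 0 => u bu; rewrite scale0r mulmxA -[RHS](mul0mx _ u); apply: in_block_eq bu => y ly ty.
  by case: nex; exists y.
have [ym|ym] := boolP (mu m).
  exists 0 => u bu; rewrite scale0r mulmxA -[RHS](mul0mx _ u); apply: in_block_eq bu => y ly ty.
  by rewrite -mulmxA (R_chi0 hx hv hchi) ?ly // mulmx0 mul0mx.
exists (theta_row chi (loc y0) m (mform x v y0)) => u bu; rewrite -mul_scalar_mx mulmxA.
apply: in_block_eq bu => y ly ty; rewrite -mulmxA (LR_chi hx hv hchi) ?ly // mul_scalar_mx.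
by rewrite -ly (theta_row_typ hv hchi (y := y0)) // ?ly0 // ty ty0.
Qed.

(** [L_m R_m] passes each [R_p] with [p != m] up to a scalar and finally acts on [u] by one. If it
    meets [R_m], the result is 0 since [R_m] squares to 0. *)
Lemma Rw_LR m s : exists c, forall u, in_block mu lam u ->
  L m *m (Rm m *m (Rw s *m u)) = c *: (Rw s *m u).
Proof.
elim: s => [|p s [c IH]] /=.
  by have [c h] := block_LR m; exists c => u bu; rewrite mul1mx h.
have [<-|mp] := eqVneq m p.
  by exists 0 => u bu; rewrite -mulmxA !(mulmxA (Rm m) (Rm m)) (RR0 R hx hv) mul0mx mulmx0
    scale0r.
have [d dE] := R_comm R hx hv mp; exists (d * c) => u bu.
rewrite -mulmxA (mulmxA (Rm m)) dE -scalemxAl -scalemxAr -mulmxA (mulmxA (L m)) (LR_comm R hx hv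
  mp).
by rewrite -mulmxA IH // -scalemxAr scalerA.
Qed.

Lemma Rw_E nu s : exists b : bool, forall u, in_block mu lam u ->
  E nu *m (Rw s *m u) = b%:R *: (Rw s *m u).
Proof.
elim: s nu => [|m s IH] nu /=.
  exists (mu == nu) => u bu; rewrite mul1mx -mul_scalar_mx; apply: in_block_eq bu => y ly _.
  by rewrite (E_chi hv hchi) ly mul_scalar_mx.
(* Before [R_m] acts, a vector at location [nu] was at [nu] with [m] removed, which requires [m] to
   be in [nu]. *)
have [b bE] := IH [ffun i => nu i && (i != m)].
exists (b && nu m) => u bu; apply: ev_inj => y; rewrite evZ -mulmxA ev_E.
rewrite ev_R; have [ly|ly] := eqVneq (loc y) nu; last first.
  have [/andP[hb num]|_] := boolP (b && nu m); last by rewrite mul0r.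
  rewrite mul1r big1 // => z cz; have [zm lz] := covers_loc hx hv cz.
  have := congr1 (fun w => ev w z) (bE u bu); rewrite hb scale1r /= ev_E => <-.
  case: eqP => // lz'; case/eqP: ly; rewrite lz lz'; apply/ffunP=> i; rewrite !ffunE.
  by case: eqP => [->|_]; rewrite ?orbT ?num // orbF andbT.
rewrite mulr_sumr; apply: eq_bigr => z cz; have [zm lz] := covers_loc hx hv cz.
have num : nu m by rewrite -ly lz ffunE eqxx orbT.
have := congr1 (fun w => ev w z) (bE u bu); rewrite evZ ev_E num andbT => <-.
rewrite (_ : loc z == _) //; apply/eqP/ffunP=> i; rewrite ffunE -ly lz ffunE.
by case: eqP => [->|_]; rewrite ?(negPf zm) ?andbF // orbF andbT.
Qed.

(** [L_m] moves to the right until it meets [R_m], where [Rw_LR] applies, or reaches [u] and kills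
    it. *)
Lemma Rw_L m s : exists B, forall u, in_block mu lam u -> L m *m (Rw s *m u) = comb B *m u.
Proof.
elim: s => [|p s [B IH]] /=.
  by exists [::] => u bu; rewrite /comb big_nil mul1mx mul0mx block_L.
have [<-|mp] := eqVneq m p.
  have [c cE] := Rw_LR m s; exists [:: (c, s)] => u bu.
  by rewrite /comb big_seq1 -mulmxA cE // scalemxAl.
exists [seq (q.1, p :: q.2) | q <- B] => u bu.
rewrite -mulmxA (mulmxA (L m)) (LR_comm R hx hv mp) -mulmxA IH // /comb big_map.
by rewrite mulmxA mulmx_sumr; congr (_ *m _); apply: eq_bigr => q _; rewrite -scalemxAr.
Qed.

Lemma comb_cat B B' : comb (B ++ B') = comb B + comb B'.
Proof. by rewrite /comb big_cat. Qed.

Lemma Hal_Rw h : Hal h -> forall s, exists B, forall u, in_block mu lam u ->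
  h *m (Rw s *m u) = comb B *m u.
Proof.
elim=> {h} [A [m|m|nu]||a A _ IH|A A' _ IHA _ IHB|A A' _ IHA _ IHB] s.
- exact: Rw_L.
- by exists [:: (1, m :: s)] => u bu; rewrite /comb big_seq1 scale1r mulmxA.
- by have [b bE] := Rw_E nu s; exists [:: (b%:R, s)] => u bu;
  rewrite /comb big_seq1 bE // scalemxAl.
- by exists [:: (1, s)] => u bu; rewrite /comb big_seq1 scale1r mul1mx.
- have [B BE] := IH s; exists [seq (a * q.1, q.2) | q <- B] => u bu.
  rewrite -scalemxAl BE // scalemxAl /comb big_map scaler_sumr; congr (_ *m _).
  by apply: eq_bigr => q _; rewrite scalerA.
- have [B BE] := IHA s; have [B' BE'] := IHB s; exists (B ++ B') => u bu.
  by rewrite mulmxDl BE // BE' // comb_cat mulmxDl.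
have [B BE] := IHB s.
suff [B' BE'] : exists B', forall u, in_block mu lam u -> A *m (comb B *m u) = comb B' *m u.
  by exists B' => u bu; rewrite -mulmxA BE // BE'.
elim: B {BE} => [|[a t] B [B' IH]]; first by exists [::] => u bu;
  rewrite /comb big_nil mul0mx mulmx0.
have [B1 B1E] := IHA t; exists ([seq (a * q.1, q.2) | q <- B1] ++ B') => u bu.
rewrite comb_cat mulmxDl -IH // {1}/comb big_cons mulmxDl mulmxDr -/(comb B); congr (_ + _).
rewrite -scalemxAl -scalemxAr B1E // scalemxAl /comb big_map scaler_sumr; congr (_ *m _).
by apply: eq_bigr => q _; rewrite scalerA.
Qed.

(** A nonempty word strictly raises dimension, so up to the dimension of the block only the empty
    word is visible. The scalar is the sum of its coefficients. *)
Lemma Hal_scalar h : Hal h -> exists c, forall u, in_block mu lam u ->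
  forall y, (\dim y <= size_loc mu)%N -> ev (h *m u) y = c * ev u y.
Proof.
move=> /Hal_Rw/(_ [::])[B BE]; exists (\sum_(p <- B | p.2 == [::]) p.1) => u bu y dy.
have := BE u bu; rewrite mul1mx => ->; rewrite /comb mulmx_suml ev_sum mulr_suml [RHS]big_mkcond.
apply: eq_bigr => -[a s] _ /=; rewrite -scalemxAl evZ; case: s => [|m s] /=;
  first by rewrite mul1mx.
rewrite [X in _ * X](_ : _ = 0) ?mulr0 //; apply/eqP/negPn/negP=> nz.
have := @in_dim_Rw _ (m :: s) _ (in_block_dim bu) _ nz.
by move=> dyE; move: dy; rewrite dyE /=; lia.
Qed.

End Block.

(** * Modules generated by a block vector: uniqueness and isomorphism *)

Lemma orbit_space u : exists U : {vspace V}, submodule Hal U /\ forall w,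
  w \in U <-> exists2 h, Hal h & w = h *m u.
Proof.
have [||U UP] := @subspace_of_pred _ V (fun w => exists2 h, Hal h & w = h *m u).
- by exists 0; [apply: Hal0|rewrite mul0mx].
- move=> a _ _ [h hh ->] [h' hh' ->]; exists (a *: h + h'); last by rewrite mulmxDl scalemxAl.
  by apply: ga_add => //; apply: ga_scale.
exists U; split=> // h hh w /UP[h' hh' ->]; apply/UP; exists (h *m h'); last by rewrite mulmxA.
exact: ga_mul.
Qed.

Lemma generated_mem W u w : generated_by Hal W u -> w \in W -> exists2 h, Hal h & w = h *m u.
Proof.
move=> [sW uW min] wW; have [U [sU UP]] := orbit_space u.
have uU : u \in U by apply/UP; exists 1%:M; [apply: ga_one|rewrite mul1mx].
by apply/UP; apply: (subvP (min U sU uU)).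
Qed.

Lemma generated_unique W mu lam mu' lam' u u' :
  column_full mu lam -> column_full mu' lam' ->
  in_block mu lam u -> in_block mu' lam' u' -> u != 0 -> u' != 0 ->
  generated_by Hal W u -> generated_by Hal W u' -> mu = mu' /\ lam = lam'.
Proof.
(* If the block of [u2] had smaller dimension, [u2 = h u1] would be a multiple of [u1] there, hence
   zero. *)
have le mu1 lam1 mu2 lam2 u1 u2 : column_full mu1 lam1 ->
   in_block mu1 lam1 u1 -> in_block mu2 lam2 u2 -> u2 != 0 ->
   generated_by Hal W u1 -> generated_by Hal W u2 -> (size_loc mu1 <= size_loc mu2)%N.
  move=> f1 b1 b2 n2 g1 [_ u2W _]; have [h hh eu2] := generated_mem g1 u2W.
  have [c cE] := Hal_scalar f1 hh; have [y nz] := ev_neq0 n2.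
  have dy := in_block_dim b2 nz; rewrite -dy leqNgt; apply/negP=> lt.
  case/eqP: nz; rewrite eu2 cE //; last exact: ltnW.
  rewrite (_ : ev u1 y = 0) ?mulr0 //; apply/eqP/negPn/negP=> nz1.
  by rewrite (in_block_dim b1 nz1) ltnn in lt.
move=> f f' b b' n0 n0' g g'.
have dd : size_loc mu = size_loc mu'.
  by apply/eqP; rewrite eqn_leq (le mu lam mu' lam' u u') // (le mu' lam' mu lam u' u).
have [h hh eu'] : exists2 h, Hal h & u' = h *m u by case: g' => _ + _; apply: generated_mem.
have [c cE] := Hal_scalar f hh.
(* In dimensions up to the common one [h] acts on [u] by [c]; above it both vectors vanish. *)
have uu' : u' = c *: u.
  apply: ev_inj => y; rewrite evZ; have [le1|lt] := leqP (\dim y) (size_loc mu);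
    first by rewrite -cE // -eu'.
  have z u0 mu0 lam0 : size_loc mu0 = size_loc mu -> in_block mu0 lam0 u0 -> ev u0 y = 0.
    move=> e b0; apply/eqP/negPn/negP=> nz; move: lt; by rewrite (in_block_dim b0 nz) e ltnn.
  by rewrite (z u' mu' lam') // (z u mu lam) // mulr0.
have [y nz] : exists y, cf y u' != 0.
  apply/existsP; apply: contraR n0'; rewrite negb_exists => /forallP c0.
  rewrite (cf_expand hv hchi u') big1 // => y _; have := c0 y; rewrite negbK => /eqP ->.
  by rewrite scale0r.
have [<- <-] := b' y nz; have [] := b y; last by [].
by move: nz; rewrite uu' -[c *: u]addr0 cfP cf0 addr0 mulf_eq0 negb_or => /andP[].
Qed.

Lemma generated_iso W W' mu lam u u' :
  column_full mu lam -> in_block mu lam u -> in_block mu lam u' -> u != 0 -> u' != 0 ->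
  generated_by Hal W u -> generated_by Hal W' u' -> module_iso Hal W W'.
Proof.
move=> f b b' n0 n0' g g'.
(* Nonzero vectors of one block have the same annihilator: [h^* h] acts by a common scalar [c],
   which [h u1 = 0] forces to be 0, and then the norm of [h u2] is 0. In dimensions above the block,
   where the scalar says nothing, the other factor of the inner product vanishes. *)
have ann u1 u2 h : in_block mu lam u1 -> in_block mu lam u2 -> u1 != 0 -> Hal h ->
  h *m u1 = 0 -> h *m u2 = 0.
  move=> b1 b2 n1 hh h0; apply: mx_pos; rewrite conj_mxM trmx_mul -mulmxA.
  have [c cE] := Hal_scalar f (ga_mul (Hal_star hh) hh).
  have c0 : c = 0.
    have [y nz] := ev_neq0 n1; have := cE u1 b1 y; rewrite (in_block_dim b1 nz) => /(_ (leqnn _)).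
    rewrite -mulmxA h0 mulmx0 ev0 => /esym/eqP; rewrite mulf_eq0 (negPf nz) orbF => /eqP //.
  apply/matrixP=> i j; rewrite [RHS]mxE mxE big1 // => k _; rewrite -[k]enum_valK.
  rewrite !ord1 -/(ev _ (enum_val k)).
  have [le1|lt] := leqP (\dim (enum_val k)) (size_loc mu).
    by rewrite mulmxA cE // c0 mul0r mulr0.
  rewrite [X in X * _](_ : _ = 0) ?mul0r //; rewrite !mxE.
  have z : ev u2 (enum_val k) = 0.
    by apply/eqP/negPn/negP=> nz; move: lt; rewrite (in_block_dim b2 nz) ltnn.
  by move: z; rewrite /ev => ->; rewrite rmorph0.
have [sW uW minW] := g; have [sW' uW' minW'] := g'.
(* The map is defined on a basis of [W], each basis vector being written as [h u] for a chosen [h];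
   [key] shows that the choice does not matter. *)
have /fin_all_exists2[hb hbH hbE] : forall i : 'I_(\dim W), exists2 h,
  Hal h & (vbasis W)`_i = h *m u.
  by move=> i; apply: generated_mem g _; apply: vbasis_mem; rewrite mem_nth ?size_tuple.
have [phi phiE] := linear_of_free (vbasis W) [seq hb i *m u' | i <- enum 'I_(\dim W)].
have {}phiE : forall i : 'I_(\dim W), phi (vbasis W)`_i = hb i *m u'.
  move=> i; have e : map phi (vbasis W) = [seq hb i *m u' | i <- enum 'I_(\dim W)].
    by apply: phiE; [exact: basis_free (vbasisP W)|rewrite size_map size_enum_ord size_tuple].
  have := congr1 (fun r : seq V => nth 0 r i) e;
    rewrite (nth_map 0) ?size_tuple // (nth_map i) ?size_enum_ord //.
  by rewrite nth_ord_enum.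
have key h : Hal h -> phi (h *m u) = h *m u'.
  move=> hh; have huW : h *m u \in W by apply: sW.
  (* [k] is the combination of chosen operators with [k u = h u]. The difference [h - k] annihilates
     [u], hence also [u']. *)
  have eh := coord_vbasis huW; pose k := \sum_i coord (vbasis W) i (h *m u) *: hb i.
  have kE u0 : k *m u0 = \sum_i coord (vbasis W) i (h *m u) *: (hb i *m u0).
    by rewrite mulmx_suml; apply: eq_bigr => i _; rewrite scalemxAl.
  have kH : Hal k.
    rewrite /k; elim/big_rec: _ => [|i A _ hA]; first exact: Hal0.
    by apply: ga_add => //; apply: ga_scale; apply: hbH.
  have ku : h *m u = k *m u by rewrite kE {1}eh; apply: eq_bigr => i _; rewrite hbE.
  have : (h - k) *m u' = 0.
    apply: (ann u u') => //; last by rewrite mulmxBl ku subrr.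
    by apply: ga_add => //; rewrite -scaleN1r; apply: ga_scale.
  rewrite mulmxBl => /eqP; rewrite subr_eq0 => /eqP ->.
  rewrite kE {1}eh linear_sum; apply: eq_bigr => i _; rewrite linearZ /=.
  by rewrite phiE.
exists (linfun phi); split.
- apply/vspaceP=> w; apply/memv_imgP/idP => [[w0 w0W ->]|wW'].
    have [h hh ->] := generated_mem g w0W; rewrite lfunE /= key //; exact: sW'.
  have [h hh ->] := generated_mem g' wW'; exists (h *m u); first exact: sW.
  by rewrite lfunE /= key.
- apply/eqP; rewrite -subv0; apply/subvP=> w;
  rewrite memv_cap memv_ker lfunE /= memv0 => /andP[wW].
  have [h hh ->] := generated_mem g wW; rewrite key // => /eqP h0.
  by apply/eqP; apply: (ann u' u).
move=> a aH w wW; have [h hh ->] := generated_mem g wW.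
by rewrite !lfunE /= key // !mulmxA key //; apply: ga_mul.
Qed.

(** * A column-full block vector in every irreducible module *)

Lemma cf_eq0 u : (forall y, cf y u = 0) -> u = 0.
Proof.
by move=> c0; rewrite (cf_expand hv hchi u) big1 // => y _; rewrite c0 scale0r.
Qed.

Lemma cf_diag (A : 'M_n) (a : {vspace H} -> R[i]) u :
  (forall y, cf y u != 0 -> A *m chiv y = a y *: chiv y) ->
    forall y, cf y (A *m u) = a y * cf y u.
Proof.
move=> Aa y; rewrite {1}(cf_expand hv hchi u) mulmx_sumr.
rewrite (eq_bigr (fun z => (cf z u * a z) *: chiv z)) => [|z _]; last first.
  rewrite -scalemxAr; have [->|/Aa ->] := eqVneq (cf z u) 0; first by rewrite mul0r !scale0r.
  by rewrite scalerA.
have -> : cf y (\sum_z (cf z u * a z) *: chiv z) = \sum_z (cf z u * a z) * cf y (chiv z).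
  by rewrite /cf linear_sum; apply: eq_bigr => z _; rewrite linearZ.
rewrite (eq_bigr (fun z => cf z u * a z * (y == z)%:R)) => [|z _];
  last by rewrite (cf_chi hv hchi).
by rewrite sum_delta [LHS]mulrC.
Qed.

Lemma cf_E mu y u : cf y (E mu *m u) = (loc y == mu)%:R * cf y u.
Proof. by apply: (@cf_diag _ (fun z => (loc z == mu)%:R)) => z _; rewrite (E_chi hv hchi). Qed.

Lemma irreducible_generated W u : irreducible_submodule Hal W -> u \in W -> u != 0 ->
  generated_by Hal W u.
Proof.
move=> [sW _ irr] uW u0; split=> // U sU uU.
have [| |e|<-] := irr (U :&: W)%VS; first 2 last.
- have : u \in (U :&: W)%VS by rewrite memv_cap uU.
  by rewrite e memv0 (negPf u0).
- exact: capvSl.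
- move=> a aH w; rewrite !memv_cap => /andP[wU wW]; rewrite sU // sW //.
exact: capvSr.
Qed.

Lemma exists_block W : irreducible_submodule Hal W ->
  exists mu lam u, [/\ admissible mu lam, column_full mu lam, in_block mu lam u,
    u != 0 & u \in W].
Proof.
move=> [sW W0 _].
(* [k] will be the least dimension of a subspace at which some vector of [W] is nonzero. *)
have exk : exists k, `[< exists w y, [/\ w \in W, ev w y != 0 & \dim y = k] >].
  have w0 : vpick W != 0 by rewrite vpick0; apply/eqP.
  have [y nz] := ev_neq0 w0; exists (\dim y); apply/asboolP; exists (vpick W), y.
  by split=> //; apply: memv_pick.
have [k /asboolP[w [y1 [wW nz dy1]]] kmin] := ex_minnP exk.
pose mu := loc y1; pose u0 := E mu *m w.
have u0W : u0 \in W by apply: sW wW; apply: Hal_E.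
have u0nz : u0 != 0.
  by apply: contraNneq nz => /(congr1 (fun t : V => ev t y1)); rewrite ev_E eqxx ev0 => ->.
have u0dim : in_dim k u0.
  move=> y; rewrite ev_E; case: (loc y =P mu) => [ly _|_]; last by rewrite eqxx.
  by rewrite -dy1 !(dim_loc hx hv) ly.
have u0loc y : cf y u0 != 0 -> loc y = mu.
  by rewrite cf_E; case: (loc y =P mu) => // _; rewrite mul0r eqxx.
(* Otherwise [W] would contain a vector that is nonzero at a subspace of dimension [k - 1]. *)
have Lu0 m : L m *m u0 = 0.
  apply/eqP/negPn/negP=> /ev_neq0[y nzL].
  have [z cz nzz] : exists2 z, covers x m z y & ev u0 z != 0.
    have [//|nex] := pselect (exists2 z, covers x m z y & ev u0 z != 0).
    case/eqP: nzL; rewrite ev_L big1 // => z cz; apply/eqP/negPn/negP=> nzz.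
    by apply: nex; exists z.
  have : (k <= \dim y)%N.
    apply: kmin; apply/asboolP; exists (L m *m u0), y; split=> //.
    by apply: sW => //; apply: Hal_L.
  by rewrite -(u0dim z nzz) (covers_dim cz) ltnn.
(* [R_m L_m] kills [u0], and it is diagonal on characters, so its eigenvalue vanishes at every
   character occurring in [u0]. *)
have u0full y : cf y u0 != 0 -> Tset mu \subset typ y.
  move=> cy; apply/subsetP=> m; rewrite inE => mum;
    rewrite -(theta_col_typ0 hv hchi) ?(u0loc y cy) //.
  have := @cf_diag (Rm m *m L m) (fun z => theta_col chi (loc z) m (mform x v z)) u0.
  move=> /(_ _ y); rewrite -mulmxA Lu0 mulmx0 cf0 => h.
  have /esym/eqP : 0 = theta_col chi (loc y) m (mform x v y) * cf y u0.
    by apply: h => z /u0loc lz; rewrite -mulmxA (RL_chi hx hv hchi) // lz.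
  by rewrite mulf_eq0 (negPf cy) orbF (u0loc y cy).
have [y0 c0] : exists y, cf y u0 != 0.
  apply/existsP; apply: contraR u0nz; rewrite negb_exists => /forallP h.
  by apply/eqP/cf_eq0=> y; apply/eqP; have := h y; rewrite negbK.
pose lam := typ y0.
have adm y : cf y u0 != 0 -> admissible mu (typ y) by move/u0loc <-; apply: admissible_typ hv _.
have cardt y : cf y u0 != 0 -> #|typ y| = (#|Tset mu| + #|Tset mu|)%N.
  (* The columns of the type are all of [T_mu], and admissibility provides equally many rows. *)
  move=> cy; have [eqc _] := adm y cy; have /setIidPr Tt := u0full y cy.
  rewrite -(cardsID (Tset mu)) Tt; congr (_ + _)%N; rewrite -{2}Tt -eqc; apply: eq_card => i.
  by rewrite !inE andbC.
(* L_m R_m acts on chi_y by a nonzero scalar if m is not in the type of y, and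
   kills it otherwise; all types involved have the same cardinality, so the
   product over the m outside lam isolates the component of type lam. *)
have prods : forall r : seq 'I_N, all (fun m => ~~ mu m) r -> exists2 u1, u1 \in W &
    forall y, cf y u1 = (\prod_(m <- r) theta_row chi (loc y) m (mform x v y)) * cf y u0.
  elim=> [_|m r IH /= /andP[mum /IH[u1 u1W u1E]]].
    by exists u0 => // y; rewrite big_nil mul1r.
  exists (L m *m (Rm m *m u1)); first exact: (sW _ (Hal_L m) _ (sW _ (Hal_R m) _ u1W)).
  move=> y; rewrite mulmxA (@cf_diag _ (fun z => theta_row chi (loc z) m (mform x v z))) => [|z].
    by rewrite u1E big_cons mulrA.
  rewrite u1E mulf_eq0 negb_or => /andP[_ /u0loc lz].
  by rewrite -mulmxA (LR_chi hx hv hchi) // lz.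
pose r := enum (~: (Tset mu :|: lam)).
have rmu : all (fun m => ~~ mu m) r.
  by apply/allP=> m; rewrite mem_enum !inE negb_or => /andP[].
have [u1 u1W u1E] := prods r rmu.
have u1lam y : cf y u1 != 0 -> loc y = mu /\ typ y = lam.
  rewrite u1E mulf_eq0 negb_or => /andP[pr cy]; have ly := u0loc y cy; split=> //.
  apply/eqP; rewrite eqEcard cardt // cardt // leqnn andbT; apply/subsetP=> m mt.
  apply/negPn/negP=> ml; have [mum|mum] := boolP (mu m).
    by case/negP: ml; apply: (subsetP (u0full y0 c0)); rewrite inE.
  have mr : m \in r by rewrite mem_enum in_setC in_setU negb_or ml andbT inE.
  case/eqP: pr; rewrite (big_rem m) //=.
  have /eqP -> : theta_row chi (loc y) m (mform x v y) == 0 by rewrite (theta_row_typ0 hv hchi)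
    ?ly.
  by rewrite mul0r.
exists mu, lam, u1; split=> //.
- exact: adm.
- exact: u0full.
have : cf y0 u1 != 0.
  rewrite u1E mulf_neq0 // prodf_seq_neq0; apply/allP=> m;
    rewrite mem_enum in_setC in_setU negb_or => /andP[+ ml] /=; rewrite inE => mum.
  by rewrite (theta_row_typ0 hv hchi) // (u0loc y0 c0).
by apply: contraNneq => ->; rewrite cf0.
Qed.

(** * Blocks and the projections onto types *)

Lemma Vtype_cf lam u : u \in Vtype x v chi lam -> forall y, cf y u != 0 -> typ y = lam.
Proof.
have [||U UP] := @subspace_of_pred _ V (fun u => forall y, cf y u != 0 -> typ y = lam).
- by move=> y; rewrite cf0 eqxx.
- move=> a u1 u2 h1 h2 y; rewrite cfP; have [->|/h1//] := eqVneq (cf y u1) 0.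
  by rewrite mulr0 add0r; apply: h2.
move=> uV; apply/UP; move: uV; apply: subvP; apply/span_subvP=> w /imageP[y + ->].
rewrite inE (typE hv) => /eqP ty; apply/UP=> z; rewrite (cf_chi hv hchi).
by case: (z =P y) => [->//|_]; rewrite eqxx.
Qed.

Lemma cf_Vtype lam u : (forall y, cf y u != 0 -> typ y = lam) -> u \in Vtype x v chi lam.
Proof.
move=> h; rewrite (cf_expand hv hchi u); apply: memv_suml => y _.
have [->|/h ty] := eqVneq (cf y u) 0; first by rewrite scale0r mem0v.
by apply/memvZ/memv_span/imageP; exists y => //; rewrite inE (typE hv) ty.
Qed.

Lemma Eproj_block mu lam u : in_block mu lam (E mu *m Eproj x v chi lam u).
Proof.
move=> y; rewrite cf_E mulf_eq0 negb_or pnatr_eq0 eqb0 negbK => /andP[/eqP ly].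
by move=> cy; split=> //; apply: Vtype_cf cy; apply: memv_pi.
Qed.

Lemma Eproj_id mu lam u : in_block mu lam u -> E mu *m Eproj x v chi lam u = u.
Proof.
move=> bu; rewrite /Eproj daddv_pi_id; last first.
- by apply: cf_Vtype => y /bu[].
(* The projection is the identity on [V_lam] only if the other summands meet [V_lam] trivially. They
   do: their vectors have zero coordinate at every character of type [lam]. *)
- apply/eqP; rewrite -subv0; apply/subvP=> w; rewrite memv_cap memv0 => /andP[wl ws].
  have [||U UP] := @subspace_of_pred _ V (fun u => forall y, typ y = lam -> cf y u = 0).
  - by move=> y _; rewrite cf0.
  - by move=> a u1 u2 h1 h2 y ty; rewrite cfP h1 // h2 // mulr0 addr0.
  have /UP wU : w \in U.
    move: ws; apply: subvP; apply/subv_sumP=> k /andP[_ kl]; apply/subvP=> w1 /Vtype_cf h.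
    apply/UP=> y ty; apply/eqP/negPn/negP=> /h tk; by rewrite -tk ty eqxx in kl.
  apply/eqP/cf_eq0=> y; apply/eqP/negPn/negP=> cy; have ty := Vtype_cf wl cy.
  by rewrite wU ?eqxx // in cy.
rewrite -[RHS]mul1mx; apply: in_block_eq bu => y ly _.
by rewrite (E_chi hv hchi) ly eqxx scale1r mul1mx.
Qed.

Lemma parametrizedP W mu lam : parametrized_by x v chi W mu lam <->
  [/\ admissible mu lam, column_full mu lam &
    exists u, [/\ in_block mu lam u, u != 0 & generated_by Hal W u]].
Proof.
split=> -[adm f [u]].
  case=> [/eqP n0 g]; split=> //; exists (E mu *m Eproj x v chi lam u); split=> //.
  exact: Eproj_block.
by case=> b n0 g; split=> //; exists u; rewrite Eproj_id //; split=> //; apply/eqP.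
Qed.

End Modules.

Theorem theorem11p4 (R : realType) (F : finFieldType) (N : nat) (hN : (0 < N)%N)
    (H : vectType F) (hH : \dim {: H} = N)
    (x : 'I_N.+1 -> {vspace H}) (hx : full_flag x)
    (v : N.-tuple H) (hv : adapted_basis x v)
    (chi : F -> R[i]) (hchi : nontrivial_character chi) :
  (forall W : {vspace 'cV[R[i]]_#|{: {vspace H}}|},
     irreducible_submodule (Halg x R) W ->
     exists! p : {ffun 'I_N -> bool} * {set 'I_N},
       parametrized_by x v chi W p.1 p.2) /\
  (forall (W W' : {vspace 'cV[R[i]]_#|{: {vspace H}}|})
          (mu : {ffun 'I_N -> bool}) (lambda : {set 'I_N}),
     irreducible_submodule (Halg x R) W ->
     irreducible_submodule (Halg x R) W' ->
     parametrized_by x v chi W mu lambda ->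
     parametrized_by x v chi W' mu lambda ->
     module_iso (Halg x R) W W').
Proof.
split=> [W irr|W W' mu lam _ _ /(parametrizedP hv hchi)[_ f [u [b n0 g]]]
  /(parametrizedP hv hchi)[_ _ [u' [b' n0' g']]]]; last exact: (generated_iso hx hv hchi f b b').
have [mu [lam [u [adm f b n0 uW]]]] := exists_block hx hv hchi irr.
have g := irreducible_generated irr uW n0.
exists (mu, lam); split=> /= [|[mu' lam'] /= /(parametrizedP hv hchi)[_ f' [u' [b' n0' g']]]].
  by apply/(parametrizedP hv hchi); split=> //; exists u.
by have [-> ->] := generated_unique hx hv hchi f f' b b' n0 n0' g g'.
Qed.
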